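(* (1) The pair $(\mathbb I^\omega,\Pi_3)$ is $\overrightarrow{\mathbf\Pi^0_3}$-absorbing and the space $\Pi_3$ is $\mathbf\Pi^0_3$-absorbing. (2) The pair $(\mathbb I^\omega,\Sigma_4)$ is $\overrightarrow{\mathbf\Sigma^0_4}$-absorbing and the space $\Sigma_4$ is $\mathbf\Sigma^0_4$-absorbing.
   Context: $\mathbb I=[0,1]$, $\omega=\{0,1,2,\dots\}$, and $\Pi_3=\{(x_i)_{i\in\omega}\in\mathbb I^\omega:\forall n\in\omega\ \exists k\ \forall m\ge k\ (x_{2^n(2m+1)}=0)\}$, $\Sigma_4=\{(x_i)_{i\in\omega}\in\mathbb I^\omega:\exists n_0\ \forall n\ge n_0\ \exists m_0\ \forall m\ge m_0\ (x_{2^n(2m+1)}=0)\}$. All spaces are separable metric and all maps are continuous. $\mathbf\Pi^0_3$ is the class of absolute $F_{\sigma\delta}$-spaces and $\mathbf\Sigma^0_4$ the class of absolute $F_{\sigma\delta\sigma}$-spaces. A map $f:X\to Y$ is approximated arbitrarily closely by maps with property $\mathcal P$ if for every open cover $\mathcal U$ of $Y$ there is a map $g:X\to Y$ with property $\mathcal P$ such that for each $x\in X$ some $U\in\mathcal U$ contains $\{f(x),g(x)\}$. A closed set $B\subset X$ is a $Z$-set in $X$ if the identity of $X$ can be approximated arbitrarily closely by maps $f:X\to X$ with $f(X)\cap B=\emptyset$. A $Z$-embedding is an embedding whose image is a $Z$-set; $f$ is a $Z$-embedding on $B$ if $f\upharpoonright B$ is a $Z$-embedding. A $\sigma$-compact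 $\sigma Z$-set in $X$ is a countable union of compact $Z$-sets in $X$. A space $X$ has SDAP if every map $f:\bigoplus_{n\in\mathbb N}\mathbb I^n\to X$ from the topological sum of finite-dimensional cubes can be approximated arbitrarily closely by maps $g$ such that the family $\{g(\mathbb I^n):n\in\mathbb N\}$ is discrete in $X$. Let $\mathcal C$ be a class of spaces. A space $X$ is strongly $\mathcal C$-universal if for each $C\in\mathcal C$ and each closed $B\subset C$, every map $f:C\to X$ which is a $Z$-embedding on $B$ can be approximated arbitrarily closely by $Z$-embeddings $g:C\to X$ with $g\upharpoonright B=f\upharpoonright B$. A space $X$ is $\mathcal C$-absorbing if $X$ is an ANR with SDAP, $X=\bigcup_{n\in\mathbb N}X_n$ with each $X_n\in\mathcal C$ a $Z$-set in $X$, and $X$ is strongly $\mathcal C$-universal. Let $\vec{\mathcal C}$ be the class of pairs $(K,C)$ with $K$ compact, $C\subset K$ and $C\in\mathcal C$. A pair $(M,X)$, $X\subset M$, is strongly $\vec{\mathcal C}$-universal if for each $(K,C)\in\vec{\mathcal C}$ and each closed $B\subset K$, every map $f:K\to M$ which is a $Z$-embedding on $B$ and satisfies $(f\upharpoonright B)^{-1}(X)=B\cap C$ can be approximated arbitrarily closely by $Z$-embeddings $g:K\to M$ with $g\upharpoonright B=f\upharpoonright B$ and $g^{-1}(X)=C$. The pair $(M,X)$ is $\vec{\mathcal C}$-absorbing if $X\in\mathcal C$, $(M,X)$ is strongly $\vec{\mathcal C}$-universal, and $X$ is contained in a $\sigma$-compact $\sigma Z$-set in $M$. *)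

(* Defs.v *)
From mathcomp Require Import all_boot all_order all_algebra.
From mathcomp Require Import boolp classical_sets functions cardinality.
From mathcomp Require Import reals topology borel_hierarchy.

Set Implicit Arguments.
Unset Strict Implicit.
Unset Printing Implicit Defensive.

Import Order.TTheory GRing.Theory Num.Theory.
Import numFieldTopology.Exports.

Local Open Scope classical_set_scope.
Local Open Scope ring_scope.

(* A subset [A : set T], used as a type, is [set_type A], which carries the
   subspace topology; [set_val : A -> T] is the inclusion.  The restriction of
   [f : T -> Y] to [A] is [f \o set_val]. *)

Definition top_embedding (X Y : topologicalType) (f : X -> Y) : Prop :=
  [/\ continuous f, injective f &
      forall U : set X, open U -> exists2 V : set Y, open V & U = f @^-1` V].

Definition metrizable (R : realType) (X : topologicalType) : Prop :=
  exists (M : metricType R) (h : X -> M),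
    top_embedding h /\ range h = [set: M].

Definition separable (X : topologicalType) : Prop :=
  exists2 D : set X, countable D & dense D.

Definition separable_metrizable (R : realType) (X : topologicalType) : Prop :=
  metrizable R X /\ separable X.

Definition open_cover (Y : topologicalType) (U : set (set Y)) : Prop :=
  (forall V, U V -> open V) /\ \bigcup_(V in U) V = [set: Y].

Definition approximated_by (X Y : topologicalType) (f : X -> Y)
    (P : (X -> Y) -> Prop) : Prop :=
  forall U : set (set Y), open_cover U ->
    exists g : X -> Y, [/\ continuous g, P g &
      forall x, exists V, [/\ U V, V (f x) & V (g x)]].

Definition Z_set (X : topologicalType) (B : set X) : Prop :=
  closed B /\
  approximated_by (@id X) (fun f : X -> X => range f `&` B = set0).

Definition Z_embedding (X Y : topologicalType) (f : X -> Y) : Prop :=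
  top_embedding f /\ Z_set (range f).

Definition Z_embedding_on (X Y : topologicalType) (B : set X) (f : X -> Y) :
  Prop := Z_embedding (f \o (set_val : B -> X)).

Definition sigma_compact_sigma_Z (X : topologicalType) (A : set X) : Prop :=
  exists2 Z : nat -> set X,
    forall n, compact (Z n) /\ Z_set (Z n) & A = \bigcup_n Z n.

(* Absolute neighbourhood retract for the class of separable metrizable
   spaces. *)
Definition ANR (R : realType) (X : topologicalType) : Prop :=
  separable_metrizable R X /\
  forall Y : topologicalType, separable_metrizable R Y ->
  forall e : X -> Y, top_embedding e -> closed (range e) ->
    exists U : set Y, [/\ open U, range e `<=` U &
      exists2 r : U -> X, continuous r &
        forall (u : U) (x : X), set_val u = e x -> r u = x].

Definition unit_interval (R : realType) : topologicalType :=
  set_type [set x : R | 0 <= x <= 1].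

Definition hilbert_cube (R : realType) : topologicalType :=
  {ptws nat -> unit_interval R}.

Definition cube (R : realType) (n : nat) : topologicalType :=
  {ptws 'I_n -> unit_interval R}.

Definition discrete_family (X : topologicalType) (A : nat -> set X) : Prop :=
  forall x : X, exists2 V : set X, nbhs x V &
    forall i j, A i `&` V !=set0 -> A j `&` V !=set0 -> i = j.

(* The topological sum is over the cubes of positive dimension, the n-th
   summand being the cube of dimension n.+1. *)
Definition SDAP (R : realType) (X : topologicalType) : Prop :=
  forall f : {n : nat & cube R n.+1} -> X, continuous f ->
    approximated_by f (fun g =>
      discrete_family (fun n => [set g (existT _ n x) | x in [set: cube R n.+1]])).

Definition Fsigmadelta (X : topologicalType) (S : set X) : Prop :=
  exists2 F : nat -> set X, (forall i, Fsigma (F i)) & S = \bigcap_i F i.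

Definition Fsigmadeltasigma (X : topologicalType) (S : set X) : Prop :=
  exists2 F : nat -> set X, (forall i, Fsigmadelta (F i)) & S = \bigcup_i F i.

(* Absoluteness: the Borel condition holds under every embedding into a
   separable metrizable space. *)
Definition absolute_class (R : realType)
    (borel : forall Y : topologicalType, set Y -> Prop) (X : topologicalType) :
    Prop :=
  separable_metrizable R X /\
  forall Y : topologicalType, separable_metrizable R Y ->
  forall e : X -> Y, top_embedding e -> borel Y (range e).

Definition abs_Pi03 (R : realType) : topologicalType -> Prop :=
  absolute_class R Fsigmadelta.

Definition abs_Sigma04 (R : realType) : topologicalType -> Prop :=
  absolute_class R Fsigmadeltasigma.

Definition strongly_universal (CC : topologicalType -> Prop)
    (X : topologicalType) : Prop :=
  forall C : topologicalType, CC C ->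
  forall B : set C, closed B ->
  forall f : C -> X, continuous f -> Z_embedding_on B f ->
    approximated_by f (fun g => Z_embedding g /\ (forall x, B x -> g x = f x)).

Definition absorbing (R : realType) (CC : topologicalType -> Prop)
    (X : topologicalType) : Prop :=
  [/\ ANR R X, SDAP R X,
      exists2 X_ : nat -> set X,
        (forall n, CC (set_type (X_ n)) /\ Z_set (X_ n)) &
        [set: X] = \bigcup_n X_ n &
      strongly_universal CC X].

(* The class of pairs (K, C) with K a compact space and C a subspace of K
   in [CC]. *)
Definition pair_class (R : realType) (CC : topologicalType -> Prop)
    (K : topologicalType) (C : set K) : Prop :=
  [/\ separable_metrizable R K, compact [set: K] & CC (set_type C)].

Definition strongly_universal_pair (R : realType)
    (CC : topologicalType -> Prop) (M : topologicalType) (X : set M) : Prop :=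
  forall (K : topologicalType) (C : set K), pair_class R CC C ->
  forall B : set K, closed B ->
  forall f : K -> M, continuous f -> Z_embedding_on B f ->
    B `&` f @^-1` X = B `&` C ->
    approximated_by f (fun g =>
      [/\ Z_embedding g, (forall x, B x -> g x = f x) & g @^-1` X = C]).

Definition absorbing_pair (R : realType) (CC : topologicalType -> Prop)
    (M : topologicalType) (X : set M) : Prop :=
  [/\ CC (set_type X), strongly_universal_pair R CC X &
      exists2 A : set M, sigma_compact_sigma_Z A & X `<=` A].

Definition Pi3 (R : realType) : set (hilbert_cube R) :=
  [set x | forall n : nat, exists k : nat, forall m : nat, (k <= m)%N ->
     set_val (x (2 ^ n * (2 * m + 1))%N) = 0 :> R].

Definition Sigma4 (R : realType) : set (hilbert_cube R) :=
  [set x | exists n0 : nat, forall n : nat, (n0 <= n)%N ->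
     exists m0 : nat, forall m : nat, (m0 <= m)%N ->
       set_val (x (2 ^ n * (2 * m + 1))%N) = 0 :> R].

Arguments Pi3 : clear implicits.
Arguments Sigma4 : clear implicits.

(* Main.v *)
Require Import Defs.
From mathcomp Require Import all_boot all_order all_algebra.
From mathcomp Require Import boolp classical_sets functions cardinality.
From mathcomp Require Import reals topology borel_hierarchy.
From HB Require Import structures.
From mathcomp Require Import mathcomp_extra normedtype numfun sequences.
From mathcomp Require Import lra ring zify.

(* Every closed set [Z] satisfying the weak definition of a Z-set in a space [Y]
   lying between the finitely supported sequences and the Hilbert cube [Q], and
   stable under changing finitely many coordinates, can be avoided by a homotopy
   of all of [Q] that moves instantaneously into [Y] off [Z].  Given a map
   [f : D -> Y] that is a Z-embedding on a closed set [B], one moves [f] off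
   [f B] along this homotopy, for a time vanishing exactly on [B], and then
   replaces the coordinates of large index by those of a code [c x] of [x].  The
   splitting index depends on the distance to [f B], so that nothing is changed on
   [B], while off [B] the tail of [g x] is that of [c x].  The tail makes [g]
   injective and closed, provided that [c x] lies in [Y] only for [x] in [D], and
   decides whether [g x] lies in a set given by a tail condition.

   A set [S] that is F_sigma-delta (F_sigma-delta-sigma) in [Q] has such a code
   with [c x] in Pi_3 (Sigma_4) iff [x] is in [S]: the entries in the [n]-th column
   of [c x] are the distances from [x] to an increasing sequence of closed sets.
   For Sigma_4 one needs F_sigma sets [E n] such that a point is in [S] iff it is in
   all but finitely many [E n].  SDAP is strong universality applied to the
   topological sum of the cubes, and X is an AR by Tietze's theorem followed by a
   truncation of the coordinates. *)

Set Implicit Arguments.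
Unset Strict Implicit.
Unset Printing Implicit Defensive.

Import Order.TTheory GRing.Theory Num.Theory.
Import numFieldNormedType.Exports.

Local Open Scope classical_set_scope.
Local Open Scope ring_scope.

(** * The Hilbert cube as a metric space *)

Lemma set_val_inj (T : Type) (A : set T) : injective (set_val : A -> T).
Proof. by rewrite set_valE => x y; exact: val_inj. Qed.

Lemma set_val_range (T : Type) (X : set T) : range (set_val : X -> T) = X.
Proof.
apply/seteqP; split=> [_ [x _ <-]|q Xq]; first exact: set_valP.
by exists (SigSub (mem_set Xq)).
Qed.

Lemma cvg_set_val (T : topologicalType) (A : set T) (I : Type)
    (F : set_system I) {FF : Filter F} (h : I -> A) (u : A) :
  h @ F --> u <-> (set_val \o h) @ F --> (set_val u : T).
Proof.
split=> [hu | hu].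
  by apply: cvg_comp; [exact: hu|exact: (@initial_continuous A T set_val)].
move=> V; rewrite nbhsE => -[W [[W' oW' <-] Wu] WV].
have : nbhs (set_val u) W' by apply: open_nbhs_nbhs.
by move=> /hu hW; apply: (@filterS _ F FF (h @^-1` (set_val @^-1` W'))) => // x Hx; exact: WV.
Qed.

Lemma ultra_fmap (T U : Type) (F : set_system T) (h : T -> U) :
  UltraFilter F -> UltraFilter (h @ F).
Proof.
move=> FU; split=> [|G GF FG]; first exact: fmap_proper_filter.
apply/seteqP; split=> // A GA.
have [//|FA] := in_ultra_setVsetC (h @^-1` A) FU.
have [|z []//] := @filter_ex _ G GF (A `&` ~` A).
by apply: filterI => //; exact: FG.
Qed.

(** Stands in for the extraction of convergent subsequences. *)
Lemma compact_ultra_cvg (T : topologicalType) (I : Type) (F : set_system I)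
    (h : I -> T) :
  compact [set: T] -> UltraFilter F -> exists p : T, h @ F --> p.
Proof.
rewrite compact_ultra => Tc FU.
have := Tc (h @ F) (ultra_fmap h FU).
by case=> [|p [_ hp]]; [exact: (@filterT _ F) | exists p].
Qed.

Lemma set_val_embedding (T : topologicalType) (A : set T) :
  top_embedding (set_val : A -> T).
Proof.
split; [exact: (@initial_continuous A T set_val) | exact: set_val_inj |].
by move=> U [V oV VU]; exists V.
Qed.

Section hilbert_cube_metric.
Context {R : realType}.
Notation Q := (hilbert_cube R).

Definition clamp (r : R) : R := Num.min 1 (Num.max 0 r).

Lemma clamp_itv r : 0 <= clamp r <= 1.
Proof. by rewrite /clamp le_min ge_min le_max !lexx ler01. Qed.

Lemma clamp_id r : 0 <= r <= 1 -> clamp r = r.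
Proof. by move=> /andP[r0 r1]; rewrite /clamp max_r // min_r. Qed.

Lemma clamp_le0 r : r <= 0 -> clamp r = 0.
Proof. by move=> r0; rewrite /clamp max_l // min_r. Qed.

Lemma clamp_ge1 r : 1 <= r -> clamp r = 1.
Proof.
by move=> r1; rewrite /clamp max_r ?min_l //; apply: le_trans r1.
Qed.

Lemma clamp_continuous : continuous (clamp : R -> R).
Proof.
move=> x; apply: (@continuous_min R R (cst 1) (Num.max 0)); first exact: cvg_cst.
by apply: (@continuous_max R R (cst 0) id); [exact: cvg_cst | exact: cvg_id].
Qed.

Lemma clamp_cvg (I : Type) (F : set_system I) {FF : Filter F} (h : I -> R) (a : R) :
  h @ F --> a -> (clamp \o h) @ F --> clamp a.
Proof. by move=> ha; apply: cvg_comp; [exact: ha|exact: clamp_continuous]. Qed.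

Definition co (p : Q) (i : nat) : R := set_val (p i).

Lemma co_itv p i : 0 <= co p i <= 1.
Proof. by rewrite /co; exact: (set_valP (p i)). Qed.

Lemma co_ge0 p i : 0 <= co p i. Proof. by case/andP: (co_itv p i). Qed.
Lemma co_le1 p i : co p i <= 1. Proof. by case/andP: (co_itv p i). Qed.

(** Clamping lets every real sequence define a point of the cube; bounds are only checked when
    coordinates are read back. *)
Definition mkI (r : R) : unit_interval R :=
  SigSub (mem_set (clamp_itv r) : clamp r \in [set x : R | 0 <= x <= 1]).

Definition mkQ (a : nat -> R) : Q := fun i => mkI (a i).

Lemma co_mkQ_clamp a i : co (mkQ a) i = clamp (a i).
Proof. by rewrite /co set_valE. Qed.

Lemma co_mkQ a i : 0 <= a i <= 1 -> co (mkQ a) i = a i.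
Proof. by move=> ai; rewrite co_mkQ_clamp clamp_id. Qed.

Lemma co_inj p q : (forall i, co p i = co q i) -> p = q.
Proof. by move=> pq; apply/funext => i; apply: set_val_inj; exact: pq. Qed.

Lemma cvgQP (I : Type) (F : set_system I) {FF : Filter F} (h : I -> Q) (p : Q) :
  h @ F --> p <-> forall i, (fun x => co (h x) i) @ F --> co p i.
Proof.
split=> [hp i|hp].
  have : (proj i \o h) @ F --> p i.
    by apply: cvg_comp; [exact: hp|exact: (@proj_continuous nat (fun=> unit_interval R) i p)].
  by move/cvg_set_val.
have H t : (fun g : Q => g t) @ (h @ F) --> p t.
  by apply/(@cvg_set_val _ _ _ F FF (fun x => h x t)); exact: hp.
exact: (proj2 (@pointwise_cvgP nat (unit_interval R) (h @ F) p _) H).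
Qed.

Lemma continuousQP (T : topologicalType) (h : T -> Q) :
  continuous h <-> forall i, continuous (fun x => co (h x) i).
Proof.
by split=> [hc i x|hc x]; [move: i; apply/cvgQP; exact: hc
  |apply/cvgQP => i; exact: hc].
Qed.

Lemma co_continuous i : continuous (fun p : Q => co p i).
Proof. by move: i; apply/continuousQP => p; exact: cvg_id. Qed.

Lemma unit_interval_compact : compact [set: unit_interval R].
Proof.
rewrite compact_ultra => F FU _.
have := @segment_compact R 0 1; rewrite compact_ultra.
have FF : ProperFilter F := ultra_proper.
move=> /(_ ((set_val : unit_interval R -> R) @ F)) [].
- exact: ultra_fmap.
- apply: (@filterS _ F _ setT _ _ (@filterT _ F _)) => x _ /=.
  by rewrite in_itv /=; exact: (co_itv (fun=> x) 0).
move=> x [/= x01 xF].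
have xI : x \in [set x : R | 0 <= x <= 1] by apply: mem_set; move: x01; rewrite in_itv.
exists (SigSub xI); split=> //=.
by apply/(@cvg_set_val _ _ _ F _ id); exact: xF.
Qed.

Lemma Q_compact : compact [set: Q].
Proof.
have := @tychonoff nat (fun=> unit_interval R) (fun=> setT)
  (fun=> unit_interval_compact).
by congr (compact _); apply/seteqP; split.
Qed.

Lemma Q_hausdorff : hausdorff_space Q.
Proof.
apply: (@hausdorff_product nat (fun=> unit_interval R)) => _.
move=> x y xy; apply: set_val_inj; apply: (@Rhausdorff R) => A B xA yB.
have sc := @initial_continuous (unit_interval R) R set_val.
have [|z [Az Bz]] := xy (set_val @^-1` A) (set_val @^-1` B) _ (sc _ _ yB).
  exact: sc xA.
by exists (set_val z).
Qed.


Local Notation e2 i := ((2^-1 : R) ^+ i).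

Lemma e2_gt0 i : 0 < e2 i. Proof. by rewrite exprn_gt0 // invr_gt0. Qed.

Lemma e2_le1 i : e2 i <= 1.
Proof. by rewrite exprn_ile1 // ?invr_ge0 // invf_le1 // ler1n. Qed.

Lemma e2_le i j : (i <= j)%N -> e2 j <= e2 i.
Proof.
by move=> ij; rewrite ler_wiXn2l // ?invr_ge0 // invf_le1 // ler1n.
Qed.

Lemma e2_small (e : R) : 0 < e -> exists N, e2 N < e.
Proof.
move=> e0; have : (fun n => e2 n) @ \oo --> (0 : R).
  by apply: cvg_expr; rewrite ger0_norm ?invr_ge0 // invf_lt1 // ltr1n.
move/cvgrPdist_lt => /(_ e e0) [N _ /(_ N)] /=; rewrite leqnn => /(_ isT).
by rewrite sub0r normrN gtr0_norm ?e2_gt0 // => ?; exists N.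
Qed.

Lemma e2K i : e2 i * 2 ^+ i = 1.
Proof. by rewrite -exprMn mulVf ?pnatr_eq0 // expr1n. Qed.

(** A supremum can be bounded one coordinate at a time, and since the weights tend to 0 it still
    induces the product topology. *)
Definition dQ (p q : Q) : R :=
  sup [set e2 i * `|co p i - co q i| | i in [set: nat]].

Lemma co_dist1 p q i : `|co p i - co q i| <= 1.
Proof.
rewrite ler_norml; have := co_itv p i; have := co_itv q i.
by move=> /andP[? ?] /andP[? ?]; apply/andP; split; lra.
Qed.

Lemma dQ_term p q i : e2 i * `|co p i - co q i| <= e2 i.
Proof. by rewrite ler_piMr ?co_dist1 // ltW // e2_gt0. Qed.

Let dQ_has_sup p q :
  has_sup [set e2 i * `|co p i - co q i| | i in [set: nat]].
Proof.
split; first by exists (e2 0 * `|co p 0 - co q 0|); exists 0%N.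
exists 1 => _ [i _ <-]; exact: le_trans (dQ_term p q i) (e2_le1 i).
Qed.

Lemma dQ_ge p q i : e2 i * `|co p i - co q i| <= dQ p q.
Proof. by apply: sup_upper_bound; [exact: dQ_has_sup | exists i]. Qed.

Lemma dQ_le p q r : (forall i, e2 i * `|co p i - co q i| <= r) -> dQ p q <= r.
Proof.
move=> H; apply: sup_le_ub; first by case: (dQ_has_sup p q).
by move=> _ [i _ <-].
Qed.

Lemma dQ_ge0 p q : 0 <= dQ p q.
Proof. by apply: le_trans (dQ_ge p q 0); rewrite mulr_ge0 // ltW // e2_gt0. Qed.

Lemma dQ_sym p q : dQ p q = dQ q p.
Proof. by rewrite /dQ; congr sup; apply/eq_imagel => i _; rewrite distrC. Qed.

Lemma dQ_triangle q p r : dQ p r <= dQ p q + dQ q r.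
Proof.
apply: dQ_le => i; apply: le_trans (lerD (dQ_ge p q i) (dQ_ge q r i)).
rewrite -mulrDr ler_wpM2l ?(ltW (e2_gt0 _)) //.
by rewrite (le_trans _ (ler_normD _ _)) // addrA subrK.
Qed.

Lemma dQxx p : dQ p p = 0.
Proof.
apply/eqP; rewrite eq_le dQ_ge0 andbT; apply: dQ_le => i.
by rewrite subrr normr0 mulr0.
Qed.

Lemma dQ_eq0 p q : dQ p q = 0 -> p = q.
Proof.
move=> d0; apply: co_inj => i; have := dQ_ge p q i.
rewrite d0 pmulr_rle0 ?e2_gt0 // normr_le0 subr_eq0 => /eqP //.
Qed.

Lemma cvgQ_dist (I : Type) (F : set_system I) {FF : Filter F} (h : I -> Q)
    (p : Q) :
  h @ F --> p <-> forall e, 0 < e -> \forall x \near F, dQ p (h x) < e.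
Proof.
split=> [/cvgQP hp e e0|hp].
  have e20 : 0 < e / 2 by rewrite divr_gt0.
  have [N Ne] := e2_small e20.
  (* Only the coordinates below [N] have to converge; each of the others contributes at most
     [2^-N]. *)
  have : \forall x \near F, forall i, (i < N)%N -> `|co p i - co (h x) i| < e / 2.
    elim: N {Ne} => [|N IH]; first by apply: filterE.
    have := hp N => /cvgrPdist_lt/(_ _ e20).
    apply: filterS2 IH => x A B i; rewrite ltnS leq_eqVlt => /orP[/eqP ->//|].
    exact: A.
  apply: filterS => x Hx; apply: le_lt_trans (_ : e / 2 < e); last by lra.
  apply: dQ_le => i; have [iN|Ni] := ltnP i N.
    rewrite -[leRHS]mul1r ler_pM ?(ltW (e2_gt0 _)) ?e2_le1 // ltW //; exact: Hx.
  apply: le_trans (dQ_term _ _ _) _; apply: le_trans (e2_le Ni) _; exact: ltW.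
apply/cvgQP => i; apply/cvgrPdist_lt => e e0.
have := hp _ (mulr_gt0 (e2_gt0 i) e0); apply: filterS => x.
by move/(le_lt_trans (dQ_ge p (h x) i)); rewrite ltr_pM2l ?e2_gt0.
Qed.

Lemma nbhsQP (p : Q) (A : set Q) :
  nbhs p A <-> exists2 e, 0 < e & forall q, dQ p q < e -> A q.
Proof.
split=> [nA|[e e0 eA]]; last first.
  have : (id : Q -> Q) @ p --> p by exact: cvg_id.
  by move/cvgQ_dist => /(_ e e0); apply: filterS => q; exact: eA.
(* The identity converges to [p] along the filter generated by the balls, so every neighbourhood of
   [p] contains a ball. *)
pose F : set_system Q := filter_from [set e : R | 0 < e] (fun e => [set q | dQ p q < e]).
have FF : Filter F.
  apply: filter_from_filter; first by exists 1 => /=.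
  move=> a b /= a0 b0; exists (Num.min a b) => /=; first by rewrite lt_min a0.
  by move=> q /=; rewrite lt_min => /andP[].
have : (id : Q -> Q) @ F --> p.
  by apply/cvgQ_dist => e e0; exists e.
by move=> /(_ A nA) [e /= e0 H]; exists e.
Qed.

Lemma closureQP (A : set Q) p :
  closure A p <-> forall e, 0 < e -> exists2 a, A a & dQ p a < e.
Proof.
split=> [cA e e0|H B /nbhsQP[e e0 eB]].
  have [|a [Aa da]] := cA [set q | dQ p q < e]; last by exists a.
  by apply/nbhsQP; exists e.
by have [a Aa da] := H e e0; exists a; split => //; exact: eB.
Qed.

Lemma closedQP (A : set Q) p : closed A ->
  (forall e, 0 < e -> exists2 a, A a & dQ p a < e) -> A p.
Proof. by move=> cA H; apply: cA; apply/closureQP. Qed.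

Lemma lip_continuous (f : Q -> R) :
  (forall p q, f p <= f q + dQ p q) -> continuous f.
Proof.
move=> fl p; apply: (proj2 (@cvgrPdist_lt _ _ _ (nbhs p) (nbhs_filter p) f (f p))) => e e0.
have /cvgQ_dist/(_ e e0) : (id : Q -> Q) @ p --> p by exact: cvg_id.
apply: filterS => q /= dpq; apply: le_lt_trans dpq.
by rewrite ler_norml; have := fl p q; have := fl q p; rewrite (dQ_sym q p); lra.
Qed.

End hilbert_cube_metric.

(** * Pseudo-distances and the truncated distance to a set *)

Section distance_to_set.
Context {R : realType}.

Record pseudo_dist (T : Type) (rho : T -> T -> R) : Prop := PseudoDist {
  pdist_ge0 : forall x y, 0 <= rho x y;
  pdistxx : forall x, rho x x = 0;
  pdist_sym : forall x y, rho x y = rho y x;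
  pdist_triangle : forall y x z, rho x z <= rho x y + rho y z }.

(* Truncating at 1 makes the distance to the empty set equal to 1. *)
Definition dset (T : Type) (rho : T -> T -> R) (A : set T) (x : T) : R :=
  inf ([set 1] `|` [set rho x a | a in A]).

Context {T : Type} {rho : T -> T -> R} (rhoP : pseudo_dist rho).
Implicit Types (A : set T) (x y : T).

Let lbound0 A x : lbound ([set 1] `|` [set rho x a | a in A]) 0.
Proof. by move=> _ [->|[a _ <-]]; [exact: ler01 | exact: pdist_ge0]. Qed.

Let has_lbound_dset A x : has_lbound ([set 1] `|` [set rho x a | a in A]).
Proof. by exists 0; exact: lbound0. Qed.

Lemma dset_ge0 A x : 0 <= dset rho A x.
Proof. by apply: lb_le_inf; [exists 1; left | exact: lbound0]. Qed.

Lemma dset_le1 A x : dset rho A x <= 1.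
Proof. by apply: ge_inf; [exact: has_lbound_dset | left]. Qed.

Lemma dset_le A x a : A a -> dset rho A x <= rho x a.
Proof. by move=> Aa; apply: ge_inf; [exact: has_lbound_dset | right; exists a]. Qed.

(** The bound [r <= 1] rules out the truncation value 1, so an almost minimal value comes from a
    point of [A]. *)
Lemma dset_lt A x r : dset rho A x < r -> r <= 1 -> exists2 a, A a & rho x a < r.
Proof.
move=> dr r1; have e0 : 0 < r - dset rho A x by rewrite subr_gt0.
have hi : has_inf ([set 1] `|` [set rho x a | a in A]).
  by split; [exists 1; left | exact: has_lbound_dset].
have [_ [->|[a Aa <-]] H] := inf_adherent e0 hi; last first.
  by exists a => //; move: H; rewrite -/(dset rho A x) addrC subrK.
by move: H; rewrite -/(dset rho A x) addrC subrK ltNge r1.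
Qed.

Lemma dset_lip A x y : dset rho A x <= dset rho A y + rho x y.
Proof.
rewrite -lerBlDr; apply: lb_le_inf; first by exists 1; left.
move=> _ [->|[a Aa <-]]; rewrite lerBlDr.
  by apply: le_trans (dset_le1 _ _) _; rewrite lerDl pdist_ge0.
apply: le_trans (dset_le _ Aa) _; rewrite addrC; exact: pdist_triangle.
Qed.

Lemma dset_eq0 A x : A x -> dset rho A x = 0.
Proof.
move=> Ax; apply/eqP; rewrite eq_le dset_ge0 andbT.
by rewrite -[leRHS](pdistxx rhoP x); exact: dset_le.
Qed.

End distance_to_set.

Section distance_to_set_in_Q.
Context {R : realType}.
Notation Q := (hilbert_cube R).

Lemma dQ_pdist : pseudo_dist (@dQ R).
Proof.
by split; [exact: dQ_ge0 | exact: dQxx | exact: dQ_sym | exact: dQ_triangle].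
Qed.

Lemma dsetQ_continuous (A : set Q) : continuous (dset (@dQ R) A).
Proof. by apply: lip_continuous => p q; exact: (dset_lip dQ_pdist). Qed.

Lemma dsetQ_closed (A : set Q) p : closed A -> dset (@dQ R) A p = 0 -> A p.
Proof.
move=> cA d0; apply: (closedQP cA) => e e0.
have [||a Aa] := @dset_lt _ _ _ dQ_pdist A p (Num.min e 1).
- by rewrite d0 lt_min e0 ltr01.
- by rewrite ge_min lexx orbT.
- by rewrite lt_min => /andP[? _]; exists a.
Qed.

End distance_to_set_in_Q.

(** * Coordinatewise convex combinations in the Hilbert cube *)

Section blend.
Context {R : realType}.
Notation Q := (hilbert_cube R).

(** The clamped weight may depend on the coordinate, so that straight segments ([seg]) and
    replacement of a tail ([splice]) are both instances. *)
Definition blend (l : nat -> R) (a b : Q) : Q :=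
  mkQ (fun i => clamp (l i) * co a i + (1 - clamp (l i)) * co b i).

Lemma co_blend l a b i :
  co (blend l a b) i = clamp (l i) * co a i + (1 - clamp (l i)) * co b i.
Proof.
rewrite co_mkQ //; have := clamp_itv (l i); have := co_itv a i; have := co_itv b i.
by move=> /andP[? ?] /andP[? ?] /andP[? ?]; apply/andP; split; nra.
Qed.

Lemma blend_zero l a b i : co a i = 0 -> co b i = 0 -> co (blend l a b) i = 0.
Proof. by move=> a0 b0; rewrite co_blend a0 b0 !mulr0 addr0. Qed.

Lemma blend1 l a b : (forall i, 1 <= l i) -> blend l a b = a.
Proof.
move=> l1; apply: co_inj => i.
by rewrite co_blend clamp_ge1 // mul1r subrr mul0r addr0.
Qed.

Lemma blend0 l a b : (forall i, l i <= 0) -> blend l a b = b.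
Proof.
move=> l0; apply: co_inj => i.
by rewrite co_blend clamp_le0 // mul0r add0r subr0 mul1r.
Qed.

Lemma blend_dist l a b r : 0 <= r ->
  (forall i, l i < 1 -> (2^-1) ^+ i * `|co a i - co b i| <= r) ->
  dQ (blend l a b) a <= r.
Proof.
move=> r0 H; apply: dQ_le => i; rewrite co_blend.
have [l1|l1] := leP 1 (l i).
  by rewrite clamp_ge1 // mul1r subrr mul0r addr0 subrr normr0 mulr0.
have := clamp_itv (l i); set s := clamp (l i) => /andP[s0 s1].
have -> : s * co a i + (1 - s) * co b i - co a i = (s - 1) * (co a i - co b i).
  by ring.
rewrite normrM mulrCA; apply: le_trans (H i l1).
rewrite ler_piMl ?mulr_ge0 ?(ltW (e2_gt0 _)) // ler_norml.
by apply/andP; split; lra.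
Qed.

Lemma blend_cvg (I : Type) (F : set_system I) {FF : Filter F}
    (l : I -> nat -> R) (a b : I -> Q) (l' : nat -> R) (a' b' : Q) :
  (forall i, (fun x => l x i) @ F --> l' i) -> a @ F --> a' -> b @ F --> b' ->
  (fun x => blend (l x) (a x) (b x)) @ F --> blend l' a' b'.
Proof.
move=> cl /cvgQP ca /cvgQP cb; apply/cvgQP => i.
have -> : (fun x => co (blend (l x) (a x) (b x)) i) =
  (fun x => clamp (l x i) * co (a x) i + (1 - clamp (l x i)) * co (b x) i).
  by apply/funext => x; rewrite co_blend.
rewrite co_blend; have cc := clamp_cvg (cl i).
apply: cvgD; first by apply: cvgM; [exact: cc | exact: ca].
apply: cvgM; last exact: cb.
by apply: cvgB; [exact: cvg_cst | exact: cc].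
Qed.

Definition seg (s : R) : Q -> Q -> Q := blend (fun=> 1 - s).

Lemma seg0 s a b : s <= 0 -> seg s a b = a.
Proof. by move=> s0; apply: blend1 => _; rewrite lerBrDr gerDl. Qed.

Lemma seg1 s a b : 1 <= s -> seg s a b = b.
Proof. by move=> s0; apply: blend0 => _; rewrite subr_le0. Qed.

Lemma seg_dist s a b : dQ (seg s a b) a <= dQ a b.
Proof.
by apply: blend_dist => [|i _]; [exact: dQ_ge0 | exact: dQ_ge].
Qed.

Lemma seg_cvg (I : Type) (F : set_system I) {FF : Filter F}
    (s : I -> R) (a b : I -> Q) (s' : R) (a' b' : Q) :
  s @ F --> s' -> a @ F --> a' -> b @ F --> b' ->
  (fun x => seg (s x) (a x) (b x)) @ F --> seg s' a' b'.
Proof.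
by move=> cs ca cb; apply: blend_cvg => // i; apply: cvgB => //; exact: cvg_cst.
Qed.

(* Keeps the coordinates of [a] of index [i] with [2^-i >= e/4] and switches to
   those of [b] once [2^-i <= e/8]. *)
Definition splice (e : R) : Q -> Q -> Q := blend (fun i => 2 - e * 2 ^+ i / 4).

Lemma splice0 a b : splice 0 a b = a.
Proof. by apply: blend1 => i; rewrite mul0r mul0r subr0 ler1n. Qed.

(** [N] depends only on the lower bound [e], which allows its use along a filter on which the
    splicing parameter varies. *)
Lemma splice_tail e : 0 < e -> exists N, forall e' i a b, e <= e' -> (N <= i)%N ->
  co (splice e' a b) i = co b i.
Proof.
move=> e0; have e80 : 0 < e / 8 by rewrite divr_gt0.
have [N Ne] := e2_small e80; exists N => e' i a b ee' Ni.
rewrite co_blend clamp_le0 ?mul0r ?add0r ?subr0 ?mul1r //.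
have h1 : (2^-1 : R) ^+ i < e' / 8.
  by apply: le_lt_trans (e2_le Ni) (lt_le_trans Ne _); lra.
have h2 := @e2K R i; have h3 : (0 : R) < 2 ^+ i by rewrite exprn_gt0.
by nra.
Qed.

(** A coordinate [i] that moves satisfies [2^-i < e / 4]. *)
Lemma splice_dist e a b : 0 <= e -> dQ (splice e a b) a <= e / 4.
Proof.
move=> e0; apply: blend_dist => [|i li]; first by rewrite divr_ge0.
apply: le_trans (dQ_term a b i) _.
have h2 := @e2K R i; have h3 : (0 : R) < 2 ^+ i by rewrite exprn_gt0.
have h4 := @e2_gt0 R i; by nra.
Qed.

Lemma splice_cvg (I : Type) (F : set_system I) {FF : Filter F}
    (s : I -> R) (a b : I -> Q) (s' : R) (a' b' : Q) :
  s @ F --> s' -> a @ F --> a' -> b @ F --> b' ->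
  (fun x => splice (s x) (a x) (b x)) @ F --> splice s' a' b'.
Proof.
move=> cs ca cb; apply: blend_cvg => // i; apply: cvgB; first exact: cvg_cst.
by do 2 (apply: cvgMl || apply: cvgMr_tmp || apply: cvgM); do ?exact: cvg_cst.
Qed.

End blend.

(** * Embeddings into the Hilbert cube *)

Section embeddings.

Lemma embedding_cvg (X Y : topologicalType) (e : X -> Y) (I : Type)
    (F : set_system I) {FF : Filter F} (h : I -> X) (x : X) :
  top_embedding e -> (h @ F --> x <-> (e \o h) @ F --> e x).
Proof.
move=> [ec ei eo]; split=> [hx|hx].
  by apply: cvg_comp; [exact: hx | exact: ec].
move=> V; rewrite nbhsE => -[W [oW Wx] WV].
have [W' oW' WE] := eo W oW.
have : nbhs (e x) W' by apply: open_nbhs_nbhs; split=> //; move: Wx; rewrite WE.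
move/hx => hW; apply: (@filterS _ F FF (h @^-1` (e @^-1` W'))) => // y Hy.
by apply: WV; rewrite WE.
Qed.

Lemma nbhs_embedding (X Y : topologicalType) (e : X -> Y) :
  continuous e -> injective e ->
  (forall x A, nbhs x A -> exists2 B, nbhs (e x) B & e @^-1` B `<=` A) ->
  top_embedding e.
Proof.
move=> ec ei H; split=> // U oU.
exists (\bigcup_(V in [set V | open V /\ e @^-1` V `<=` U]) V).
  by apply: bigcup_open => V [].
apply/seteqP; split=> [x Ux|x [V [_ VU] Vx]]; last exact: VU.
have [|B + BU] := H x U; first exact: open_nbhs_nbhs.
rewrite nbhsE => -[W [oW Wx] WB]; exists W => //; split => //.
by move=> y Wy; apply: BU; exact: WB.
Qed.

Lemma closed_map_embedding (X Y : topologicalType) (e : X -> Y) :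
  continuous e -> injective e -> (forall A, closed A -> closed (e @` A)) ->
  top_embedding e.
Proof.
move=> ec ei H; split=> // U oU; exists (~` (e @` (~` U))).
  by apply: closed_openC; apply: H; exact: open_closedC.
apply/seteqP; split=> [x Ux [y nUy /ei yx]|x nx].
  by apply: nUy; rewrite yx.
by apply: contrapT => nUx; apply: nx; exists x.
Qed.

Lemma compact_embedding (X Y : topologicalType) (e : X -> Y) :
  compact [set: X] -> hausdorff_space Y -> continuous e -> injective e ->
  top_embedding e.
Proof.
move=> Xc Yh ec ei; apply: closed_map_embedding => // A cA.
apply: compact_closed => //; apply: continuous_compact.
  exact: continuous_subspaceT.
exact: subclosed_compact Xc _.
Qed.

Lemma comp_embedding (X Y Z : topologicalType) (e : X -> Y) (f : Y -> Z) :
  top_embedding e -> top_embedding f -> top_embedding (f \o e).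
Proof.
move=> [ec ei eo] [fc fi fo]; split.
- by move=> x; apply: continuous_comp; [exact: ec | exact: fc].
- exact: inj_comp.
- move=> U /eo[V /fo[W oW ->] ->]; by exists W.
Qed.

Lemma id_embedding (X : topologicalType) : top_embedding (@id X).
Proof. by split; [move=> x; exact: cvg_id | by [] | move=> U oU; exists U]. Qed.

End embeddings.

Section embeddings_in_Q.
Context {R : realType}.
Notation Q := (hilbert_cube R).

Section given_embedding.
Context {Y : topologicalType} {iota : Y -> Q} (emb : top_embedding iota).

Lemma emb_inj : injective iota. Proof. by case: emb. Qed.

Lemma emb_continuous : continuous iota. Proof. by case: emb. Qed.

Lemma emb_cvg (I : Type) (F : set_system I) {FF : Filter F} (h : I -> Y) y :
  h @ F --> y <-> (fun x => iota (h x)) @ F --> iota y.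
Proof. exact: embedding_cvg. Qed.

Lemma emb_nbhs y A :
  nbhs y A <-> exists2 e, 0 < e & forall z, dQ (iota y) (iota z) < e -> A z.
Proof.
split=> [|[e e0 eA]].
  rewrite nbhsE => -[U [oU Uy] UA]; case: emb => _ _ /(_ U oU) [V oV UV].
  have : nbhs (iota y) V by apply: open_nbhs_nbhs; split=> //; move: Uy; rewrite UV.
  by move/nbhsQP => [e e0 eV]; exists e => // z /eV Vz; apply: UA; rewrite UV.
have : nbhs (iota y) [set q | dQ (iota y) q < e] by apply/nbhsQP; exists e.
by move/emb_continuous => /= n; apply: (@filterS _ (nbhs y) _ _ _ _ n) => z; exact: eA.
Qed.

Lemma emb_closed (A : set Y) :
  closed A <->
  forall y, (forall e, 0 < e -> exists2 a, A a & dQ (iota y) (iota a) < e) -> A y.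
Proof.
split=> [cA y H|H y cy].
  apply: cA => B /emb_nbhs[e e0 eB]; have [a Aa da] := H e e0.
  by exists a; split=> //; exact: eB.
apply: H => e e0; have [|a [Aa da]] := cy [set z | dQ (iota y) (iota z) < e].
  by apply/emb_nbhs; exists e.
by exists a.
Qed.

Lemma emb_open (A : set Y) :
  open A <->
  forall y, A y -> exists2 e, 0 < e & forall z, dQ (iota y) (iota z) < e -> A z.
Proof.
rewrite openE; split=> [oA y /oA /emb_nbhs //|H y /H Ay].
exact/emb_nbhs.
Qed.

Lemma emb_dset_gt0 (A : set Y) y : closed A -> ~ A y ->
  0 < dset (@dQ R) (iota @` A) (iota y).
Proof.
move=> cA nAy; rewrite lt_neqAle (dset_ge0 dQ_pdist) andbT eq_sym.
apply/eqP => d0; apply: nAy; apply: (proj1 (emb_closed A) cA) => e e0.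
have [||_ [a Aa <-] H] := @dset_lt _ _ _ dQ_pdist (iota @` A) (iota y) (Num.min e 1).
- by rewrite d0 lt_min e0 ltr01.
- by rewrite ge_min lexx orbT.
- by exists a => //; move: H; rewrite lt_min => /andP[].
Qed.

End given_embedding.

End embeddings_in_Q.

Section metric_of_dist.
Context {R : realType} {T : choiceType} {rho : T -> T -> R}.
Hypotheses (rhoP : pseudo_dist rho) (rho0 : forall x y, rho x y = 0 -> x = y).

(** An alias of [T] that mentions the two hypotheses, so that the metric structure built from them
    can be attached to it. *)
Definition dist_space : Type := let _ := (rhoP, rho0) in T.

HB.instance Definition _ := Choice.copy dist_space T.
HB.instance Definition _ := isMetric.Build R dist_space
  (pdistxx rhoP) rho0 (pdist_sym rhoP) (pdist_triangle rhoP).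

Lemma metric_of_dist :
  exists (M : metricType R) (h : T -> M) (h' : M -> T),
    [/\ cancel h h', cancel h' h & forall x y, mdist (h x) (h y) = rho x y].
Proof. by exists dist_space, id, id. Qed.

End metric_of_dist.

Section separable_metrizable_subspaces_of_Q.
Context {R : realType}.
Notation Q := (hilbert_cube R).

Lemma metric_emb_nbhs (T : topologicalType) (M : metricType R) (h : T -> M) x A :
  top_embedding h ->
  nbhs x A <-> exists2 e, 0 < e & forall y, mdist (h x) (h y) < e -> A y.
Proof.
move=> [hc hi ho]; split=> [|[e e0 eA]].
  rewrite nbhsE => -[U [oU Ux] UA]; have [V oV UV] := ho U oU.
  have : nbhs (h x) V by apply: open_nbhs_nbhs; split=> //; move: Ux; rewrite UV.
  move/nbhs_ballP => [e /= e0 eV]; exists e => // y xy; apply: UA; rewrite UV.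
  by apply: eV; rewrite ballEmdist.
have : nbhs (h x) (ball (h x) e) by exact: nbhsx_ballx.
move/hc => /= n; apply: (@filterS _ (nbhs x) _ _ _ _ n) => y /=.
by rewrite ballEmdist; exact: eA.
Qed.

Lemma mdist_pdist (M : metricType R) : pseudo_dist (@mdist R M).
Proof.
split; [exact: mdist_ge0 | exact: mdistxx | exact: metric_sym |].
by move=> y x z; exact: metric_triangle.
Qed.

Lemma embedding_metrizable (Y : topologicalType) (io : Y -> Q) :
  top_embedding io -> metrizable R Y.
Proof.
move=> emb.
have rhoP : pseudo_dist (fun y z => dQ (io y) (io z)).
  split=> *; [exact: dQ_ge0 | exact: dQxx | exact: dQ_sym | exact: dQ_triangle].
have [M [h [h' [hK h'K hE]]]] := metric_of_dist rhoP
  (fun x y xy => emb_inj emb (dQ_eq0 xy)).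
exists M, h; split; last by apply/seteqP; split=> // m _; exists (h' m).
apply: nbhs_embedding => [y A|y z /(can_inj hK) //|y A].
  move/nbhs_ballP => [e /= e0 eA]; apply/(emb_nbhs emb); exists e => // z yz.
  by apply: eA; rewrite ballEmdist /= hE.
move/(emb_nbhs emb) => [e e0 eA]; exists (ball (h y) e); first exact: nbhsx_ballx.
by move=> z; rewrite /preimage /= ballEmdist /= hE; exact: eA.
Qed.

(** The first [k] coordinates rounded down to multiples of [2^-k]. There are countably many cells,
    and points of one cell are within [2^-k] of each other. *)
Let cell (Y : Type) (io : Y -> Q) (k : nat) (y : Y) : seq int :=
  [seq Num.floor (2 ^+ k * co (io y) i) | i <- iota 0 k].

Let cell_close (Y : Type) (io : Y -> Q) k y z :
  cell io k y = cell io k z -> dQ (io y) (io z) <= (2^-1) ^+ k.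
Proof.
move=> yz; apply: dQ_le => i; have [ik|ki] := ltnP i k; last first.
  exact: le_trans (dQ_term _ _ _) (e2_le ki).
have := congr1 (fun s => nth 0 s i) yz.
rewrite /= !(nth_map 0%N) ?size_iota // !nth_iota // add0n => fl.
have e0 := @e2_gt0 R k; have e1 := @e2_le1 R i; have e3 := @e2_gt0 R i.
suff : `|co (io y) i - co (io z) i| <= (2^-1) ^+ k.
  move=> H; rewrite -[leRHS]mul1r; apply: ler_pM => //; exact: ltW.
have eK := @e2K R k; have p0 : (0 : R) < 2 ^+ k by rewrite exprn_gt0.
have := Num.Theory.floor_itv (2 ^+ k * co (io y) i).
have := Num.Theory.floor_itv (2 ^+ k * co (io z) i).
rewrite fl; move: (Num.floor _) => f; rewrite rmorphD /=.
move=> /andP[a1 a2] /andP[b1 b2]; rewrite ler_norml; apply/andP; split; nra.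
Qed.

Lemma embedding_separable (Y : topologicalType) (io : Y -> Q) :
  top_embedding io -> separable Y.
Proof.
move=> emb.
(* One point is picked in each nonempty cell, the cells being enumerated by [pickle]; the picked
   points form the dense set [D]. *)
have gP (n : nat) : exists o : option Y, forall k s, unpickle n = Some (k, s) ->
    forall y, cell io k y = s -> exists2 z, o = Some z & cell io k z = s.
  case E : (unpickle n) => [[k s]|]; last by exists None.
  have [[z zs]|nz] := pselect (exists z, cell io k z = s).
    by exists (Some z) => _ _ [<- <-] y _; exists z.
  by exists None => _ _ [<- <-] y ys; case: nz; exists y.
have {gP}[g gP] := choice gP.
pose D := [set y | exists n, g n = Some y].
have fP (y : Y) : exists n, D y -> g n = Some y.
  have [[n gn]|nD] := pselect (D y); first by exists n.
  by exists 0%N => /nD.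
have {fP}[f fP] := choice fP.
exists D.
  apply/countable_injP; exists f => y z /set_mem Dy /set_mem Dz fyz.
  by have := fP y Dy; rewrite fyz (fP z Dz) => -[].
move=> U [y Uy] /(emb_open emb)/(_ _ Uy)[e e0 eU].
have [k ke] := e2_small e0.
have [z gz zs] := gP (pickle (k, cell io k y)) _ _ (pickleK _) y erefl.
exists z; split; last by exists (pickle (k, cell io k y)).
by apply: eU; apply: le_lt_trans ke; apply: cell_close.
Qed.

Lemma embedding_separable_metrizable (Y : topologicalType) (io : Y -> Q) :
  top_embedding io -> separable_metrizable R Y.
Proof.
by move=> emb; split; [exact: embedding_metrizable emb|exact: embedding_separable emb].
Qed.

(* The [i]-th coordinate is the distance to the [i]-th point of a countable
   dense set. *)
Lemma separable_metrizable_embedding (Y : topologicalType) :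
  separable_metrizable R Y -> exists j : Y -> Q, top_embedding j.
Proof.
move=> [[M [h [emb _]]] [S /countable_injP[f finj] Sd]].
(* The set has at most one point, as [f] is injective on [S]; when it is empty the coordinate is
   constantly 1. *)
pose D i : Y -> R := fun y => dset (@mdist R M) (h @` (S `&` f @^-1` [set i])) (h y).
have Dlip i y z : D i y <= D i z + mdist (h y) (h z).
  exact: (dset_lip (mdist_pdist M)).
pose j y : Q := mkQ (fun i => D i y).
have coj y i : co (j y) i = D i y.
  by rewrite co_mkQ // (dset_ge0 (mdist_pdist M)) (dset_le1 (mdist_pdist M)).
have near_pt y (e : R) : 0 < e -> exists2 s, S s & mdist (h y) (h s) < e.
  move=> e0; have : nbhs y [set z | mdist (h y) (h z) < e].
    by apply/(metric_emb_nbhs _ _ emb); exists e.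
  rewrite nbhsE => -[U [oU Uy] UB]; have [|s [Us Ss]] := Sd U _ oU.
    by exists y.
  by exists s => //; exact: UB.
(* One coordinate suffices: the distance to a dense point [s] within [e' / 3] of [y]. If it differs
   by less than [e' / 3] at [z], then [z] is within [2 * e' / 3] of [s]; [e' <= 1] keeps clear of
   the truncation. *)
have key y (e : R) : 0 < e -> exists i (d : R), 0 < d /\
    forall z, `|co (j y) i - co (j z) i| < d -> mdist (h y) (h z) < e.
  move=> e0; pose e' := Num.min e 1.
  have e'0 : 0 < e' by rewrite lt_min e0 ltr01.
  have e'1 : e' <= 1 by rewrite ge_min lexx orbT.
  have e'e : e' <= e by rewrite ge_min lexx.
  have [s Ss ys] := near_pt y (e' / 3) (divr_gt0 e'0 (ltr0Sn _ _)).
  exists (f s), (e' / 3); split; first by rewrite divr_gt0.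
  move=> z; rewrite !coj ltr_norml => /andP[H1 H2].
  have Ds : D (f s) y <= mdist (h y) (h s).
    by apply: (dset_le (mdist_pdist M)); exists s.
  have [||_ [s' [Ss' fs'] <-] zs'] := @dset_lt _ _ _ (mdist_pdist M)
    (h @` (S `&` f @^-1` [set f s])) (h z) (2 * e' / 3).
  - by rewrite -/(D (f s) z); lra.
  - by lra.
  have E : s' = s by apply: finj => //; exact: mem_set.
  rewrite E in zs'; apply: le_lt_trans (metric_triangle _ (h s) _) _.
  by rewrite (metric_sym (h s)); lra.
exists j; apply: nbhs_embedding.
- apply/continuousQP => i y; rewrite (_ : (fun x => _) = D i); last first.
    by apply/funext => z; rewrite coj.
  apply: (proj2 (@cvgrPdist_lt _ _ _ (nbhs y) (nbhs_filter y) _ _)) => e e0.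
  apply/(metric_emb_nbhs _ _ emb); exists e => // z yz; apply: le_lt_trans yz.
  rewrite ler_norml; have := Dlip i y z; have := Dlip i z y.
  by rewrite (metric_sym (h z)); lra.
- move=> y z yz; case: emb => _ hi _; apply: hi; apply: mdist_positivity.
  apply/eqP; rewrite eq_le mdist_ge0 andbT leNgt; apply/negP => e0.
  have [i [d [d0 H]]] := key y _ e0.
  by have := H z; rewrite yz subrr normr0 ltxx => /(_ d0).
- move=> y A /(metric_emb_nbhs _ _ emb)[e e0 eA].
  have [i [d [d0 H]]] := key y _ e0.
  exists [set q | `|co (j y) i - co q i| < d]; last by move=> z /= /H; exact: eA.
  exact: (proj1 (@cvgrPdist_lt _ _ _ (nbhs (j y)) (nbhs_filter (j y)) _ _)
    (@co_continuous R i (j y)) d d0).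
Qed.

End separable_metrizable_subspaces_of_Q.

(** * Z-sets *)

Section Z_sets.
Context {R : realType}.
Notation Q := (hilbert_cube R).

(* Taking [a = b] shows that membership in [E] is not affected by changing
   finitely many coordinates. *)
Definition tail_ideal (E : set Q) : Prop :=
  E (mkQ (fun=> 0)) /\
  forall a b z : Q, E a -> E b ->
    (exists N, forall i, (N <= i)%N -> co a i = 0 -> co b i = 0 -> co z i = 0) ->
    E z.

Lemma tail_ideal_tail (E : set Q) a z : tail_ideal E -> E a ->
  (exists N, forall i, (N <= i)%N -> co z i = co a i) -> E z.
Proof.
by move=> [_ H] Ea [N HN]; apply: (H a a z) => //; exists N => i Ni a0 _; rewrite HN.
Qed.

Lemma tail_ideal_blend (E : set Q) l a b : tail_ideal E -> E a -> E b ->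
  E (blend l a b).
Proof.
by move=> [_ H] Ea Eb; apply: (H a b) => //; exists 0%N => i _; exact: blend_zero.
Qed.

Lemma tail_ideal_finite (E : set Q) z : tail_ideal E ->
  (exists N, forall i, (N <= i)%N -> co z i = 0) -> E z.
Proof.
move=> [E0 H] [N HN]; apply: (H _ _ z E0 E0); exists N => i Ni _ _; exact: HN.
Qed.

Context {Y : topologicalType} {io : Y -> Q} (emb : top_embedding io).
Hypothesis Eideal : tail_ideal (range io).

Lemma lift_through (T : topologicalType) (h : T -> Q) :
  continuous h -> (forall x, range io (h x)) ->
  exists2 g : T -> Y, continuous g & forall x, io (g x) = h x.
Proof.
move=> hc hE.
have /choice[g gE] : forall x, exists y, io y = h x.
  by move=> x; case: (hE x) => y _ yx; exists y.
exists g => // x; apply/(emb_cvg emb); rewrite gE.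
by apply: cvg_trans (hc x); apply: near_eq_cvg; apply: nearW => z; rewrite gE.
Qed.

(** A Lebesgue function of the cover: the supremum of the radii up to 1 whose ball meets [Y] inside
    one member. It is defined and 1-Lipschitz on all of [Q], where it may vanish outside [Y], so it
    can be evaluated along a homotopy of [Q]. *)
Lemma cover_radius (U : set (set Y)) : open_cover U ->
  exists eps : Q -> R,
    [/\ forall p, 0 <= eps p <= 1,
        forall p q, eps p <= eps q + dQ p q,
        forall y, 0 < eps (io y) &
        forall y z, dQ (io y) (io z) < eps (io y) ->
          exists V, [/\ U V, V y & V z]].
Proof.
move=> [Uo Uc].
(* The value 0 is included so that the supremum is taken over a nonempty set at every point of
   [Q]. *)
pose S p := [set r : R | r = 0 \/ [/\ 0 <= r <= 1 &
  exists2 V, U V & forall y, dQ p (io y) < r -> V y]].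
have hsS p : has_sup (S p).
  split; first by exists 0; left.
  by exists 1 => r [->|[/andP[]]].
have leS p r : S p r -> r <= sup (S p).
  by move=> Sr; apply: sup_upper_bound.
exists (fun p => sup (S p)); split.
- move=> p; rewrite leS; last by left.
  apply: sup_le_ub => [|r [->|[/andP[]]//]]; last exact: ler01.
  by case: (hsS p).
- move=> p q; apply: sup_le_ub; first by case: (hsS p).
  have s0 : 0 <= sup (S q) by apply: leS; left.
  move=> r [->|[/andP[r0 r1] [V UV HV]]]; first by rewrite addr_ge0 ?dQ_ge0.
  have [rd|dr] := leP r (dQ p q); first by rewrite (le_trans rd) // lerDr.
  rewrite -lerBlDr; apply: leS; right; split.
    by rewrite subr_ge0 ltW //= (le_trans _ r1) // gerBl dQ_ge0.
  exists V => // y; rewrite ltrBrDl => H; apply: HV.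
  exact: le_lt_trans (dQ_triangle q _ _) H.
- move=> y; have : [set: Y] y by [].
  rewrite -Uc => -[V UV Vy]; have oV := Uo V UV.
  have [e e0 eV] := proj1 (emb_open emb V) oV y Vy.
  apply: (@lt_le_trans _ _ (Num.min e 1)); first by rewrite lt_min e0 ltr01.
  apply: leS; right; split; first by rewrite le_min (ltW e0) ler01 ge_min lexx orbT.
  by exists V => // z; rewrite lt_min => /andP[/eV].
- move=> y z H; have e0 : 0 < sup (S (io y)) - dQ (io y) (io z) by rewrite subr_gt0.
  have [r Sr] := sup_adherent e0 (hsS (io y)).
  rewrite opprB addrC subrK => dr; case: Sr dr => [->|[/andP[r0 r1] [V UV HV]] dr].
    by rewrite ltNge dQ_ge0.
  exists V; split=> //; apply: HV => //.
  by rewrite dQxx; apply: le_lt_trans dr; exact: dQ_ge0.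
Qed.

Definition off (Z : set Y) (q : Q) : Prop := range io q /\ ~ (io @` Z) q.

Lemma off_dset_gt0 Z q : closed Z -> off Z q -> 0 < dset (@dQ R) (io @` Z) q.
Proof.
move=> cZ [[y _ <-] nZ]; by apply: (emb_dset_gt0 emb) => // Zy; apply: nZ.
Qed.

(* [Q] is first moved into the finitely supported sequences, which lie in
   [range io], so that the approximation of the identity of [Y] applies. *)
Lemma Z_set_push_off (Z : set Y) (e : R) : Z_set Z -> 0 < e ->
  exists chi : Q -> Q,
    [/\ continuous chi, forall p, dQ p (chi p) <= e & forall p, off Z (chi p)].
Proof.
move=> [cZ ZZ] e0; have e20 : 0 < e / 2 by rewrite divr_gt0.
have [N Ne] := e2_small e20.
pose tr (p : Q) : Q := mkQ (fun i => if (i < N)%N then co p i else 0).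
have cotr p i : co (tr p) i = if (i < N)%N then co p i else 0.
  by rewrite co_mkQ //; case: ifP => _; rewrite ?co_itv // lexx ler01.
have trc : continuous tr.
  apply/continuousQP => i p.
  rewrite (_ : (fun x => _) = fun q => if (i < N)%N then co q i else 0); last first.
    by apply/funext => q; rewrite cotr.
  by case: (i < N)%N; [exact: co_continuous | exact: (@cst_continuous Q R 0)].
have trE p : range io (tr p).
  apply: tail_ideal_finite Eideal _; exists N => i Ni.
  by rewrite cotr ltnNge Ni.
have trd p : dQ p (tr p) <= e / 2.
  apply: dQ_le => i; rewrite cotr; case: ltnP => iN.
    by rewrite subrr normr0 mulr0 ltW.
  rewrite -(_ : co (mkQ (fun=> 0)) i = 0); last by rewrite co_mkQ // lexx ler01.
  exact: le_trans (dQ_term _ _ _) (le_trans (e2_le iN) (ltW Ne)).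
have [psi psic psiE] := lift_through trc trE.
(* Two points in a common ball of radius [e / 4] are less than [e / 2] apart, which with the
   truncation error gives [e]. *)
pose U := [set V | exists y, V = [set z | dQ (io y) (io z) < e / 4]].
have e40 : 0 < e / 4 by rewrite divr_gt0.
have [|phi [phic phiZ phid]] := ZZ U.
  split=> [_ [y ->]|].
    apply/(emb_open emb) => z /= yz; exists (e / 4 - dQ (io y) (io z)).
      by rewrite subr_gt0.
    move=> w zw; apply: le_lt_trans (dQ_triangle (io z) _ _) _.
    by rewrite addrC -ltrBrDr.
  apply/seteqP; split=> // y _; exists [set z | dQ (io y) (io z) < e / 4].
    by exists y.
  by rewrite /= dQxx.
exists (io \o phi \o psi); split.
- move=> p; apply: (continuous_comp (psic p)).
  by apply: continuous_comp; [exact: phic | exact: (emb_continuous emb)].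
- move=> p; apply: le_trans (dQ_triangle (tr p) _ _) _.
  have [V [[y ->] /= H1 H2]] := phid (psi p).
  have := dQ_triangle (io y) (tr p) (io (phi (psi p))).
  rewrite -psiE (dQ_sym (io (psi p)) (io y)) => H3; have := trd p; rewrite -psiE /=.
  by lra.
- move=> p; split; first by exists (phi (psi p)).
  move=> [z Zz /(emb_inj emb) zE].
  have : (range phi `&` Z) z by split=> //; exists (psi p).
  by rewrite phiZ.
Qed.

(** * An instantaneous homotopy of the Hilbert cube off a Z-set *)

Section homotopy.
Context {Z : set Y} (ZZ : Z_set Z).

Let e2 n : R := (2^-1) ^+ n.

(** The invariant of the construction: times from [2 * 2^-n] on are already off [Z], and the factor
    [1 - 2^-n] leaves room for the displacements of all later steps. *)
Let good (n : nat) (H : Q * R -> Q) : Prop :=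
  [/\ continuous H,
      forall p (t : R), 0 <= t -> dQ (H (p, t)) p <= (1 - e2 n) * t &
      forall p t, 2 * e2 n <= t -> t <= 1 -> off Z (H (p, t))].

(** Over these times the distance from [H (p, t)] to [Z] has a compact, hence closed, set of values,
    and 0 is not one of them. *)
Let margin n H : good n H -> exists2 eta : R, 0 < eta &
  forall p t, 2 * e2 n <= t -> t <= 1 ->
  forall z, Z z -> eta <= dQ (H (p, t)) (io z).
Proof.
move=> [Hc _ Hoff]; have [cZ _] := ZZ.
pose K := [set: Q] `*` [set` `[2 * e2 n, 1]].
have Kc : compact K by apply: compact_setX; [exact: Q_compact | exact: segment_compact].
pose D x := dset (@dQ R) (io @` Z) (H x).
have Dc : continuous D.
  by move=> x; exact: (cvg_comp H _ (Hc x) (@dsetQ_continuous R (io @` Z) (H x))).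
have DKc : closed (D @` K).
  apply: compact_closed; first exact: Rhausdorff.
  by apply: continuous_compact => //; exact: continuous_subspaceT.
have n0 : ~ (D @` K) 0.
  move=> [[p t] [_ /=]]; rewrite in_itv /= => /andP[t1 t2] D0.
  by have := off_dset_gt0 cZ (Hoff p t t1 t2); rewrite -/(D (p, t)) D0 ltxx.
have : nbhs (0 : R) (~` (D @` K)).
  by apply: open_nbhs_nbhs; split=> //; exact: closed_openC.
move=> /nbhs_ballP[eta /= eta0 etaB]; exists eta => // p t t1 t2 z Zz.
have DK : (D @` K) (D (p, t)) by exists (p, t) => //; split=> //=; rewrite in_itv /= t1.
apply: le_trans (_ : D (p, t) <= _).
  rewrite leNgt; apply/negP => lt; apply: (etaB (D (p, t))) => //.
  by rewrite /ball /= sub0r normrN ger0_norm // (dset_ge0 dQ_pdist).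
by apply: (dset_le dQ_pdist); exists z.
Qed.

(* [H] is composed with a map [chi] off [Z] on the times between [2^-n] and
   [2 * 2^-n], and interpolated with it nearby; [chi] is closer to the identity
   than the margin, so that the later times stay off [Z]. *)
Let step n H : good n H -> exists2 H', good n.+1 H' &
  forall p t, 4 * e2 n <= t -> H' (p, t) = H (p, t).
Proof.
move=> gH; have [eta eta0 Heta] := margin gH; have [Hc Hd Hoff] := gH.
have en := @e2_gt0 R n; have en1 := @e2_gt0 R n.+1.
have eS : e2 n = 2 * e2 n.+1 by rewrite /e2 exprS mulrA mulfV ?mul1r // pnatr_eq0.
(* [eta / 2] keeps the later times off [Z]. The square is at most [2^-(n+1) * t] once [t] exceeds
   [2^-(n+1)], which is the increase of the displacement bound from [n] to [n + 1]. *)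
pose d := Num.min (eta / 2) (e2 n.+1 * e2 n.+1).
have d0 : 0 < d by rewrite lt_min divr_gt0 //= mulr_gt0.
have [chi [chic chid chioff]] := Z_set_push_off ZZ d0.
(* A tent, clamped by [seg]: 1 on [[2^-n, 2 * 2^-n]], and 0 below [2^-(n+1)] and above
   [4 * 2^-n]. *)
pose s (t : R) := Num.min (2 ^+ n.+1 * t - 1) (2 - 2 ^+ n * t / 2).
have sc : continuous s.
  move=> t; apply: (@continuous_min R R (fun t => 2 ^+ n.+1 * t - 1)
    (fun t => 2 - 2 ^+ n * t / 2)).
    by apply: cvgB; [apply: cvgM; [exact: cvg_cst|exact: cvg_id]|exact: cvg_cst].
  apply: cvgB; first exact: cvg_cst.
  by apply: cvgM; [apply: cvgM; [exact: cvg_cst|exact: cvg_id]|exact: cvg_cst].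
have eK := @e2K R n; have eK1 := @e2K R n.+1.
have p0 : (0 : R) < 2 ^+ n by rewrite exprn_gt0.
have p1 : (0 : R) < 2 ^+ n.+1 by rewrite exprn_gt0.
have s_lo t : t <= e2 n.+1 -> s t <= 0.
  by move=> ht; rewrite /s ge_min; apply/orP; left; rewrite -/(e2 n.+1) in eK1; nra.
have s_hi t : 4 * e2 n <= t -> s t <= 0.
  by move=> ht; rewrite /s ge_min; apply/orP; right; rewrite -/(e2 n) in eK; nra.
have s_mid t : e2 n <= t <= 2 * e2 n -> 1 <= s t.
  rewrite -/(e2 n) -/(e2 n.+1) in eK eK1 => /andP[h1 h2].
  by rewrite /s le_min; apply/andP; split; nra.
pose H' x := seg (s x.2) (H x) (chi (H x)).
have H'H x : dQ (H' x) (H x) <= d.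
  by apply: le_trans (chid _); exact: seg_dist.
exists H'; last by move=> p t /s_hi st; rewrite /H' seg0.
split.
- move=> x; apply: seg_cvg; last 2 first.
  + exact: Hc.
  + by apply: continuous_comp; [exact: Hc | exact: chic].
  + by apply: continuous_comp; [exact: cvg_snd | exact: sc].
- move=> p t t0; have := Hd p t t0; have [tl|tl] := leP t (e2 n.+1).
    by rewrite /H' seg0 ?s_lo //= eS; nra.
  move=> h; apply: le_trans (dQ_triangle (H (p, t)) _ _) _.
  have := H'H (p, t); have : d <= e2 n.+1 * e2 n.+1 by rewrite ge_min lexx orbT.
  rewrite eS in h; have : e2 n.+1 * e2 n.+1 <= e2 n.+1 * t by rewrite ler_pM2l // ltW.
  by lra.
- move=> p t t1 t2; have [tl|tl] := leP (2 * e2 n) t; last first.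
    by rewrite /H' seg1 //= s_mid // eS t1 -eS ltW.
  have [HE HZ] := Hoff p t tl t2; have [cE cZ] := chioff (H (p, t)).
  split; first exact: tail_ideal_blend.
  move=> [z Zz zE]; have := Heta p t tl t2 z Zz.
  rewrite zE dQ_sym; have := H'H (p, t).
  have : d <= eta / 2 by rewrite ge_min lexx.
  by lra.
Qed.

(** The limit of the iterates of [step]. Each time [t > 0] is affected by finitely many steps only,
    since step [n] changes nothing from [4 * 2^-n] on; continuity at time 0 comes from the
    displacement bound. *)
Lemma Z_set_homotopy : exists H : Q * R -> Q,
  [/\ continuous H, forall p, H (p, 0) = p,
      forall p (t : R), 0 <= t -> dQ (H (p, t)) p <= t &
      forall p (t : R), 0 < t -> t <= 1 -> off Z (H (p, t))].
Proof.
(* For [n = 0] no time lies between [2 * 2^0] and 1, so the constant homotopy qualifies. *)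
have good0 : good 0 fst.
  split=> [x|p t t0|p t]; first exact: cvg_fst.
    by rewrite dQxx /e2 expr0 subrr mul0r.
  by rewrite /e2 expr0 mulr1 => h1 h2; lra.
(* The index is bundled with the homotopy, which turns [step] into a function that can be
   iterated. *)
have /choice[next nextP] : forall x : {n & {H | good n H}},
    exists y : {n & {H | good n H}}, tag y = (tag x).+1 /\
      forall p t, 4 * e2 (tag x) <= t ->
        sval (tagged y) (p, t) = sval (tagged x) (p, t).
  move=> [n [H gH]]; have [H' gH' H'H] := step gH.
  by exists (existT _ n.+1 (exist _ H' gH')).
pose S n := iter n next (existT _ 0%N (exist _ _ good0)).
have tagS n : tag (S n) = n by elim: n => //= n IH; rewrite (nextP _).1 IH.
pose h n := sval (tagged (S n)).
have hgood n : good n (h n) by rewrite -{1}(tagS n); exact: (svalP (tagged (S n))).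
have hst n m p t : 4 * e2 n <= t -> h (n + m)%N (p, t) = h n (p, t).
  move=> nt; elim: m => [|m IH]; first by rewrite addn0.
  rewrite -IH addnS; apply: (nextP (S (n + m)%N)).2.
  rewrite tagS; apply: le_trans nt; rewrite ler_pM2l //; exact: e2_le (leq_addr _ _).
have /choice[N NP] : forall t : R, exists n, 0 < t -> 4 * e2 n <= t.
  move=> t; have [t0|] := boolP (0 < t); last by exists 0%N.
  have [|n nt] := @e2_small R (t / 4); first by rewrite divr_gt0.
  by exists n => _; rewrite mulrC -ler_pdivlMr // ltW.
pose H x := if 0 < x.2 then h (N x.2) x else x.1.
have HE n p t : 0 < t -> 4 * e2 n <= t -> H (p, t) = h n (p, t).
  move=> t0 nt; rewrite /H /= t0 -(hst _ n _ _ (NP t t0)) addnC; exact: hst.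
have Hd p t : 0 <= t -> dQ (H (p, t)) p <= t.
  move=> t0; rewrite /H /=; case: ifP => [tp|]; last by rewrite dQxx.
  have [_ hd _] := hgood (N t); apply: le_trans (hd p t t0) _.
  by have := @e2_gt0 R (N t); rewrite -/(e2 _); nra.
exists H; split=> //.
- move=> [p t]; have [t0|t0] := ltP 0 t.
    (* With [t / 8] in place of [t / 4], the single iterate [h n] represents [H] at all times above
       [t / 2]. *)
    have [|n nt] := @e2_small R (t / 8); first by rewrite divr_gt0.
    have e : \forall x \near (p, t), h n x = H x.
      have n2 : nbhs t [set u | t / 2 < u].
        by apply: open_nbhs_nbhs; split; [exact: open_gt | rewrite /=; lra].
      exists (setT, [set u | t / 2 < u]) => /=; first by split=> //; exact: filterT.
      move=> [q u] /= [_ hu].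
      rewrite -(HE n) //; first by lra.
      by rewrite -/(e2 n) in nt; lra.
    have [hc _ _] := hgood n.
    rewrite /continuous_at (HE n) //; last by rewrite -/(e2 n) in nt; lra.
    by apply: cvg_trans (hc (p, t)); exact: near_eq_cvg.
  rewrite /continuous_at {2}/H /= ltNge t0 /=.
  apply/cvgQ_dist => e e0; have e20 : 0 < e / 2 by rewrite divr_gt0.
  have n1 : nbhs p [set q | dQ p q < e / 2] by apply/nbhsQP; exists (e / 2).
  have n2 : nbhs t [set u | u < e / 2].
    by apply: open_nbhs_nbhs; split; [exact: open_lt | exact: le_lt_trans e20].
  exists ([set q | dQ p q < e / 2], [set u | u < e / 2]) => //= -[q u] /= [pq ue].
  apply: le_lt_trans (dQ_triangle q _ _) _; rewrite (dQ_sym q).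
  have [u0|u0] := leP 0 u; first by have := Hd q u u0; lra.
  by rewrite /H /= (ltNge 0) (ltW u0) /= dQxx; lra.
- by move=> p; rewrite /H /= ltxx.
- move=> p t t0 t1; have [|n nt] := @e2_small R (t / 4); first by rewrite divr_gt0.
  rewrite -/(e2 n) in nt.
  rewrite (HE n) //; last by lra.
  by have [_ _] := hgood n; apply => //; have := @e2_gt0 R n; rewrite -/(e2 n); lra.
Qed.

End homotopy.

End Z_sets.

(** * Strong universality *)

Lemma cvg_map (I : Type) (T U : topologicalType) (F : set_system I)
    {FF : Filter F} (f : I -> T) (g : T -> U) (a : T) :
  f @ F --> a -> continuous g -> (fun x => g (f x)) @ F --> g a.
Proof. by move=> fa gc; apply: cvg_comp; [exact: fa | exact: gc]. Qed.

Section min_max_limits.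
Context {R : realType} (I : Type) (F : set_system I) {FF : Filter F}.

Lemma min_cvg (a b : I -> R) (a' b' : R) : a @ F --> a' -> b @ F --> b' ->
  (fun x => Num.min (a x) (b x)) @ F --> Num.min a' b'.
Proof.
move=> ca cb; rewrite minr_absE (_ : (fun x => _) =
  fun x => (a x + b x - `|a x - b x|) / 2); last by apply/funext => x; rewrite minr_absE.
apply: cvgM; last exact: cvg_cst.
by apply: cvgB; [exact: cvgD|apply: cvg_norm; exact: cvgB].
Qed.

Lemma max_cvg (a b : I -> R) (a' b' : R) : a @ F --> a' -> b @ F --> b' ->
  (fun x => Num.max (a x) (b x)) @ F --> Num.max a' b'.
Proof.
move=> ca cb; rewrite maxr_absE (_ : (fun x => _) =
  fun x => (a x + b x + `|a x - b x|) / 2); last by apply/funext => x; rewrite maxr_absE.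
apply: cvgM; last exact: cvg_cst.
by apply: cvgD; [exact: cvgD|apply: cvg_norm; exact: cvgB].
Qed.

End min_max_limits.

Section universality.
Context {R : realType}.
Notation Q := (hilbert_cube R).
Context {Y : topologicalType} {io : Y -> Q} (emb : top_embedding io).
Hypothesis Eideal : tail_ideal (range io).

Lemma ultra_cvg_itv (I : Type) (F : set_system I) (s : I -> R) :
  UltraFilter F -> (forall x, 0 <= s x <= 1) ->
  exists2 s' : R, 0 <= s' & s @ F --> s'.
Proof.
move=> FU s01; have := @segment_compact R 0 1; rewrite compact_ultra.
move=> /(_ (s @ F) (ultra_fmap s FU)) [|s' [/= s'01 ss']].
  apply: (@filterS _ F _ setT _ _ (@filterT _ F _)) => x _ /=.
  by rewrite in_itv /=; exact: s01.
by exists s' => //; move: s'01; rewrite in_itv /= => /andP[].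
Qed.

Section push.
Context {Z : set Y} (ZZ : Z_set Z) {U : set (set Y)} (Uc : open_cover U).

(* [G (p, t, v)] moves [p] off [Z] by the homotopy, for a time bounded by [t],
   and then replaces a tail of the coordinates by that of [v]. *)
Lemma push_off_Z_set : exists G : Q -> R -> Q -> Q,
  [/\ forall (I : Type) (F : set_system I) (p v : I -> Q) (t : I -> R) p' v' t',
        Filter F -> p @ F --> p' -> t @ F --> t' -> v @ F --> v' ->
        (fun x => G (p x) (t x) (v x)) @ F --> G p' t' v',
      forall y (t : R) v z, 0 <= t -> t <= 1 -> io z = G (io y) t v ->
        exists V, [/\ U V, V y & V z],
      forall y v, Z y -> G (io y) 0 v = io y,
      forall y (t : R) v, 0 < t -> t <= 1 -> range io v -> off (io := io) Z (G (io y) t v)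
        /\ exists N, forall i, (N <= i)%N -> co (G (io y) t v) i = co v i &
      forall (I : Type) (F : set_system I) (p : I -> Y) (v : I -> Q) (t : I -> R)
          v' y,
        UltraFilter F -> (forall x, 0 <= t x <= 1) -> v @ F --> v' ->
        (fun x => G (io (p x)) (t x) (v x)) @ F --> io y ->
        (exists N, forall i, (N <= i)%N -> co (io y) i = co v' i) \/
        [/\ Z y, p @ F --> y & t @ F --> 0]].
Proof.
have [cZ _] := ZZ.
have [eps [eps01 epsl eps0 epsU]] := cover_radius emb Uc.
have [H [Hc H0 Hd Hoff]] := Z_set_homotopy emb Eideal ZZ.
have epsc : continuous eps := lip_continuous epsl.
pose dZ := dset (@dQ R) (io @` Z).
have dZl p q : dZ p <= dZ q + dQ p q := dset_lip dQ_pdist _ _ _.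
have dZc : continuous dZ := lip_continuous dZl.
have dZ0 p : 0 <= dZ p := dset_ge0 dQ_pdist _ _.
(* The homotopy uses at most a quarter of the cover radius, which leaves room for the splice. *)
pose s p t := Num.min t (eps p) / 4.
pose h p t := H (p, s p t).
(* A splice with parameter [De q] moves [q] by at most [De q / 4]: it respects the cover, does not
   reach [Z] from outside, and changes nothing on [Z]. *)
pose De q := Num.min (eps q) (dZ q).
pose G p t v := splice (De (h p t)) (h p t) v.
have s01 p t : 0 <= t -> t <= 1 -> 0 <= s p t <= 1.
  move=> t0 t1; have /andP[e0 e1] := eps01 p.
  have m0 : 0 <= Num.min t (eps p) by rewrite le_min t0.
  have m1 : Num.min t (eps p) <= 1 by rewrite ge_min t1.
  by apply/andP; split; rewrite /s; lra.
have s_gt0 y t : 0 < t -> 0 < s (io y) t.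
  by move=> t0; rewrite /s divr_gt0 // lt_min t0 eps0.
have De0 q : 0 <= De q by rewrite /De le_min dZ0 andbT; case/andP: (eps01 q).
have sc (I : Type) (F : set_system I) (p : I -> Q) (t : I -> R) p' t' :
    Filter F -> p @ F --> p' -> t @ F --> t' ->
    (fun x => s (p x) (t x)) @ F --> s p' t'.
  move=> FF pp' tt'; apply: cvgM; last exact: cvg_cst.
  apply: min_cvg => //; exact: (cvg_map pp' epsc).
have hc (I : Type) (F : set_system I) (p : I -> Q) (t : I -> R) p' t' :
    Filter F -> p @ F --> p' -> t @ F --> t' ->
    (fun x => h (p x) (t x)) @ F --> h p' t'.
  move=> FF pp' tt'.
  apply: (@cvg_map _ _ _ F FF (fun x => (p x, s (p x) (t x))) H (p', s p' t') _ Hc).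
  exact: (cvg_pair pp' (sc _ _ _ _ _ _ FF pp' tt')).
have Dec (I : Type) (F : set_system I) (q : I -> Q) q' :
    Filter F -> q @ F --> q' -> (fun x => De (q x)) @ F --> De q'.
  move=> FF qq'; apply: min_cvg.
    exact: (cvg_map qq' epsc).
  exact: (cvg_map qq' dZc).
exists G; split.
- move=> I F p v t p' v' t' FF pp' tt' vv'; apply: splice_cvg => //.
    by apply: Dec; exact: hc.
  exact: hc.
- move=> y t v z t0 t1 zE; apply: epsU; rewrite zE.
  have /andP[s0 s1] := s01 (io y) t t0 t1.
  have d1 := Hd (io y) _ s0; rewrite -/(h _ _) in d1.
  have sle : s (io y) t <= eps (io y) / 4.
    by rewrite /s ler_pM2r ?invr_gt0 // ge_min lexx orbT.
  have d2 := @splice_dist R (De (h (io y) t)) (h (io y) t) v (De0 _).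
  rewrite -/(G _ _ _) in d2.
  have d3 : De (h (io y) t) <= eps (h (io y) t) by rewrite /De ge_min lexx.
  have d4 := epsl (h (io y) t) (io y); have d5 := eps0 y.
  have := dQ_triangle (h (io y) t) (io y) (G (io y) t v).
  by rewrite (dQ_sym (io y) (h _ _)) (dQ_sym (h _ _) (G _ _ _)); lra.
- move=> y v Zy; have s0 : s (io y) 0 = 0.
    by rewrite /s min_l ?mul0r //; case/andP: (eps01 (io y)).
  rewrite /G /h s0 H0 (_ : De (io y) = 0) ?splice0 //.
  rewrite /De (_ : dZ (io y) = 0) ?min_r ?(ltW (eps0 y)) //.
  by apply: (dset_eq0 dQ_pdist); exists y.
- move=> y t v t0 t1 Ev; have ho : off (io := io) Z (h (io y) t).
    by apply: Hoff; [exact: s_gt0 | case/andP: (s01 (io y) t (ltW t0) t1)].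
  have dp : 0 < dZ (h (io y) t) := off_dset_gt0 emb cZ ho.
  have Dp : 0 < De (h (io y) t).
    rewrite /De lt_min dp andbT; case: ho => [[z _ <-] _]; exact: eps0.
  split; last first.
    by have [N HN] := splice_tail Dp; exists N => i Ni; exact: HN.
  have [hE _] := ho; split; first exact: tail_ideal_blend.
  move=> [z Zz zE].
  have d2 := @splice_dist R (De (h (io y) t)) (h (io y) t) v (De0 _).
  rewrite -/(G _ _ _) -zE in d2.
  have d3 : De (h (io y) t) <= dZ (h (io y) t) by rewrite /De ge_min lexx orbT.
  have d4 : dZ (h (io y) t) <= dQ (h (io y) t) (io z).
    by apply: (dset_le dQ_pdist); exists z.
  by rewrite dQ_sym in d4; lra.
- move=> I F p v t v' y FU t01 vv' Gy.
  have FF : ProperFilter F by exact: ultra_proper.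
  have FF' : Filter F by exact: filter_filter.
  have [a pa] := compact_ultra_cvg (io \o p) (@Q_compact R) FU.
  have [t' t'0 tt'] := ultra_cvg_itv FU t01.
  have hq := hc I F _ _ _ _ FF' pa tt'.
  have Dq := Dec I F _ _ FF' hq.
  set q := h a t' in hq Dq.
  (* If the limit parameter is positive, the parameters are eventually above half of it, and one [N]
     serves for all of them. *)
  have [Dq0|Dq0] := ltP 0 (De q).
    left; have D20 : 0 < De q / 2 by rewrite divr_gt0.
    have [N HN] := splice_tail D20; exists N => i Ni.
    have Gi := proj1 (@cvgQP R I F FF' _ _) Gy i; have vi := proj1 (@cvgQP R I F FF' _ _) vv' i.
    apply: (cvg_unique (@Rhausdorff R) Gi); apply: cvg_trans vi.
    apply: near_eq_cvg; move: Dq => /cvgrPdist_lt /(_ _ D20); apply: filterS => x.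
    by rewrite ltr_norml => /andP[_ ?]; rewrite /G HN //= ; lra.
  (* A vanishing limit parameter makes [q] itself the limit, so [q = io y] with [y] in [Z]. As the
     homotopy is off [Z] at positive times, the limit time is 0. *)
  right; have Dq1 : De q = 0 by apply/eqP; rewrite eq_le Dq0 De0.
  have qy : q = io y.
    apply: (cvg_unique (@Q_hausdorff R) _ Gy).
    have E : splice (De q) q v' = q by rewrite Dq1 splice0.
    by rewrite /= -[X in _ --> X]E; exact: splice_cvg.
  have Zy : Z y.
    apply: contrapT => nZy; have := emb_dset_gt0 emb cZ nZy.
    by move: Dq0; rewrite qy /De ge_min leNgt eps0 /= leNgt => /negP.
  have s'0 : s a t' = 0.
    apply/eqP; rewrite eq_le; apply/andP; split; last first.
      by rewrite /s divr_ge0 // le_min t'0; case/andP: (eps01 a).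
    rewrite leNgt; apply/negP => sp.
    have s1 : s a t' <= 1.
      have /andP[_ e1] := eps01 a.
      have : Num.min t' (eps a) <= 1 by rewrite ge_min e1 orbT.
      by rewrite /s; lra.
    have [_] := Hoff a _ sp s1; by apply; exists y.
  have ay : a = io y by rewrite -qy /q /h s'0 H0.
  split=> //; first by apply/(emb_cvg emb); rewrite -ay; exact: pa.
  rewrite (_ : 0 = t') //; apply/eqP; rewrite eq_sym.
  have /eqP : s a t' = 0 := s'0.
  rewrite /s mulf_eq0 invr_eq0 pnatr_eq0 orbF; have := eps0 y; rewrite -ay.
  by rewrite minElt; case: ifP => // _ h1 /eqP h2; rewrite h2 ltxx in h1.
Qed.

End push.

Section universal_map.
Context {D : topologicalType} {j : D -> Q} (embj : top_embedding j).
Context {c : Q -> Q} (cc : continuous c).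
Hypothesis cE : forall x, range io (c (j x)).
Hypothesis c_reduct :
  forall p, closure (range j) p -> range io (c p) -> range j p.
Hypothesis c_inj :
  forall p q, p <> q -> forall N, exists2 i, (N <= i)%N & co (c p) i <> co (c q) i.
Context {w : Q} (Ew : range io w).
Hypothesis w_zero :
  forall N, exists i, [/\ (N <= i)%N, co w i <> 0 & forall p, co (c p) i = 0].

(** [c_inj] gives injectivity off [B]; [c_reduct] gives closedness, a limit of the codes lying in
    [Y] only over a point of [D]. Tails equal to that of [w] are never tails of codes, which makes
    the image a Z-set. *)
Lemma universal_map (B : set D) (f : D -> Y) (U : set (set Y)) :
  closed B -> continuous f -> Z_embedding_on B f -> open_cover U ->
  exists g : D -> Y,
    [/\ continuous g, Z_embedding g, forall x, B x -> g x = f x,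
        forall x, exists V, [/\ U V, V (f x) & V (g x)] &
        forall x, ~ B x ->
          exists N, forall i, (N <= i)%N -> co (io (g x)) i = co (c (j x)) i].
Proof.
move=> cB fc [fBemb ZZ] Uc; set Z := range _ in ZZ.
have ZB x : B x -> Z (f x).
  by move=> Bx; exists (SigSub (mem_set Bx)).
have BZ y : Z y -> exists2 b, B b & y = f b.
  by move=> [b _ <-]; exists (set_val b) => //; exact: set_valP.
(* [f] is 1-Lipschitz for [rho], so that points of [D] close to [B] are close
   to points of [B] with close images. *)
pose rho x y := Num.max (dQ (j x) (j y)) (dQ (io (f x)) (io (f y))).
have rhoP : pseudo_dist rho.
  split=> [x y|x|x y|y x z]; rewrite /rho.
  - by rewrite le_max dQ_ge0.
  - by rewrite !dQxx maxxx.
  - by rewrite (dQ_sym (j x)) (dQ_sym (io (f x))).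
  - rewrite ge_max; apply/andP; split.
      by apply: le_trans (dQ_triangle (j y) _ _) _; rewrite lerD // le_max lexx.
    apply: le_trans (dQ_triangle (io (f y)) _ _) _.
    by rewrite lerD // le_max lexx orbT.
pose beta := dset rho B.
have beta01 x : 0 <= beta x <= 1 by rewrite (dset_ge0 rhoP) (dset_le1 rhoP).
have betal x y : beta x <= beta y + rho x y := dset_lip rhoP _ _ _.
have near_rho x (e : R) : 0 < e -> nbhs x [set z | rho x z < e].
  move=> e0; have n1 : nbhs x [set z | dQ (j x) (j z) < e].
    by apply/(emb_nbhs embj); exists e.
  have n2 : nbhs x [set z | dQ (io (f x)) (io (f z)) < e].
    have : nbhs (f x) [set z | dQ (io (f x)) (io z) < e].
      by apply/(emb_nbhs emb); exists e.
    exact: fc.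
  by apply: filterS2 n1 n2 => z; rewrite /rho /= gt_max => -> ->.
have betac : continuous beta.
  move=> x; apply: (proj2 (@cvgrPdist_lt _ _ _ (nbhs x) (nbhs_filter x) _ _)) => e e0.
  apply: filterS (near_rho x e e0) => z /= xz; apply: le_lt_trans xz.
  rewrite ler_norml; have := betal x z; have := betal z x.
  by rewrite (pdist_sym rhoP z); lra.
have beta_gt0 x : ~ B x -> 0 < beta x.
  move=> nB; rewrite lt_neqAle (dset_ge0 rhoP) andbT eq_sym.
  apply/eqP => b0; apply: nB; apply: (proj1 (emb_closed embj B) cB) => e e0.
  have [||b Bb] := @dset_lt _ _ _ rhoP B x (Num.min e 1).
  - by rewrite -/(beta x) b0 lt_min e0 ltr01.
  - by rewrite ge_min lexx orbT.
  by rewrite lt_min gt_max => /andP[/andP[? _] _]; exists b.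
have beta0 x : B x -> beta x = 0 := @dset_eq0 _ _ _ rhoP B x.
have [G [Gc Gclose GZ Goff Glim]] := push_off_Z_set ZZ Uc.
pose h x := G (io (f x)) (beta x) (c (j x)).
have hB x : B x -> h x = io (f x).
  by move=> Bx; rewrite /h beta0 // GZ //; exact: ZB.
have hnB x : ~ B x -> off (io := io) Z (h x) /\
    exists N, forall i, (N <= i)%N -> co (h x) i = co (c (j x)) i.
  by move=> nB; apply: Goff; [exact: beta_gt0 | case/andP: (beta01 x) | exact: cE].
have cjc : continuous (c \o j).
  by move=> x; exact: (cvg_map (emb_continuous embj (x := x)) cc).
have hc : continuous h.
  move=> x; apply: Gc; [|exact: betac|exact: cjc].
  exact: (cvg_map (fc x) (emb_continuous emb)).
have hE x : range io (h x).
  have [Bx|nB] := pselect (B x); first by rewrite hB //; exists (f x).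
  by case: (hnB x nB) => -[].
have [g gc gE] := lift_through emb hc hE.
have gB x : B x -> g x = f x.
  by move=> Bx; apply: (emb_inj emb); rewrite gE hB.
have fBi x y : B x -> B y -> f x = f y -> x = y.
  move=> Bx By xy; case: fBemb => _ fi _.
  by have /(congr1 set_val) := fi (SigSub (mem_set Bx)) (SigSub (mem_set By)) xy.
have gsep x y : B x -> ~ B y -> g x <> g y.
  move=> Bx nBy /(congr1 io); rewrite !gE hB // => E.
  by have [[_ nZ] _] := hnB y nBy; apply: nZ; exists (f x) => //; exact: ZB.
have gi : injective g.
  move=> x y; have [Bx|nBx] := pselect (B x); have [By|nBy] := pselect (B y).
  - by rewrite !gB //; exact: fBi.
  - by move/(gsep _ _ Bx nBy).
  - by move/esym/(gsep _ _ By nBx).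
  - move=> /(congr1 io); rewrite !gE => E.
    have [_ [N HN]] := hnB x nBx; have [_ [M HM]] := hnB y nBy.
    apply: (emb_inj embj); apply: contrapT => ne.
    have [i] := c_inj ne (maxn N M); rewrite geq_max => /andP[Ni Mi]; apply.
    by rewrite -HN // -HM // E.
have gclosed A : closed A -> closed (g @` A).
  move=> cA; apply/(emb_closed emb) => y Hy.
  (* Points of [A] whose images approach [io y]; along a finer ultrafilter the points [j x] converge
     as well. *)
  pose F0 : set_system D := filter_from [set e : R | 0 < e]
    (fun e => A `&` [set x | dQ (io y) (h x) < e]).
  have F0P : ProperFilter F0.
    apply: filter_from_proper => [|e /= e0]; last first.
      by have [_ [x Ax <-]] := Hy e e0; rewrite gE => xe; exists x.
    apply: filter_from_filter; first by exists 1 => /=.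
    move=> a b /= a0 b0; exists (Num.min a b) => /=; first by rewrite lt_min a0.
    by move=> x [Ax] /=; rewrite lt_min => /andP[].
  have [F [FU F0F]] := ultraFilterLemma F0P.
  have FF : ProperFilter F by exact: ultra_proper.
  have FF' : Filter F by exact: filter_filter.
  have FA : F A by apply: F0F; exists 1 => //= x [].
  have hy : h @ F --> io y.
    by apply/cvgQ_dist => e e0; apply: F0F; exists e => // x [].
  have Alim x : (id : D -> D) @ F --> x -> A x.
    move=> Fx; apply: cA => V Vx; have FV : F V := Fx V Vx.
    by have [z] := @filter_ex _ F _ _ (filterI FA FV); exists z.
  have [p jp] := compact_ultra_cvg j (@Q_compact R) FU.
  have cjp : (c \o j) @ F --> c p by exact: cvg_map jp cc.
  (* Either [y] has the tail of [c p], so that [c p] is in [Y] and [p] comes from [D], or the points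
     approach [B] while [y] is in [f B]. *)
  have [[N HN]|[Zy fy b0]] := Glim _ F f (c \o j) beta (c p) y FU beta01 cjp hy.
    have Ecp : range io (c p).
      apply: (tail_ideal_tail Eideal (a := io y)); first by exists y.
      by exists N => i Ni; rewrite HN.
    have [||x _ xp] := c_reduct (p := p) => //.
      apply/closureQP => e e0; have := proj1 (@cvgQ_dist R D F FF' _ _) jp e e0.
      by move=> /filter_ex[z zp]; exists (j z).
    have Fx : (id : D -> D) @ F --> x.
      by apply/(emb_cvg embj); rewrite xp; exact: jp.
    exists x; first exact: Alim.
    apply: (emb_inj emb); rewrite gE; apply: (cvg_unique (@Q_hausdorff R) _ hy).
    exact: (cvg_map Fx hc).
  have [b Bb yb] := BZ y Zy; exists b; last by rewrite gB.
  apply: Alim; apply/(emb_cvg embj); apply/cvgQ_dist => e e0.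
  have e20 : 0 < e / 2 by rewrite divr_gt0.
  (* As [beta x] is small, [x] is [rho]-close to some [b'] in [B]. Then [f b'] is close to [f b],
     hence [b'] to [b], because [f] is an embedding on [B]. *)
  have embB := comp_embedding fBemb emb.
  have nb : nbhs (SigSub (mem_set Bb) : B) [set b' | dQ (j b) (j (set_val b')) < e / 2].
    have nD : nbhs b [set b' | dQ (j b) (j b') < e / 2].
      by apply/(emb_nbhs embj); exists (e / 2).
    have [sc _ _] := set_val_embedding B.
    exact: (sc (SigSub (mem_set Bb)) _ nD).
  have [d d0 dP] := proj1 (emb_nbhs embB _ _) nb.
  pose r := Num.min (Num.min (d / 2) (e / 2)) 1.
  have r0 : 0 < r by rewrite !lt_min ltr01 e20 divr_gt0.
  have d20 : 0 < d / 2 by rewrite divr_gt0.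
  have f1 : \forall x \near F, beta x < r.
    move: b0 => /cvgrPdist_lt /(_ r r0); apply: filterS => x.
    by rewrite sub0r normrN ger0_norm //; case/andP: (beta01 x).
  have f2 : \forall x \near F, dQ (io y) (io (f x)) < d / 2.
    exact: (proj1 (@cvgQ_dist R D F FF' _ _) (proj1 (@emb_cvg R Y io emb D F FF' _ _) fy)).
  apply: filterS2 f1 f2 => x bx fx.
  have [|b' Bb'] := dset_lt rhoP bx; first by rewrite /r ge_min lexx orbT.
  rewrite /r !lt_min !gt_max => /andP[/andP[/andP[h1 h2] /andP[h3 h4]] _].
  have := dP (SigSub (mem_set Bb')); rewrite /= => h5.
  have h6 : dQ (j b) (j b') < e / 2.
    apply: h5; change (dQ (io (f b)) (io (f b')) < d); rewrite -yb.
    by apply: le_lt_trans (dQ_triangle (io (f x)) _ _) _; lra.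
  apply: le_lt_trans (dQ_triangle (j b') _ _) _; rewrite (dQ_sym (j b')) /=.
  by lra.
have gemb : top_embedding g by exact: closed_map_embedding.
exists g; split=> //.
- split=> //; split; first by apply: gclosed; exact: closedT.
  (* The identity is approximated by pushing [Y] off [Z] and installing the tail of [w]: the first
     avoids [f B], the second avoids [g] off [B]. *)
  move=> U' U'c; have [G' [G'c G'close _ G'off _]] := push_off_Z_set ZZ U'c.
  pose k y := G' (io y) 1 w.
  have koff y := G'off y 1 w ltr01 (lexx _) Ew.
  have kc : continuous k.
    by move=> y; apply: G'c; [exact: (emb_continuous emb)|exact: cvg_cst|exact: cvg_cst].
  have kE y : range io (k y) by case: (koff y) => -[].
  have [phi phic phiE] := lift_through emb kc kE.
  exists phi; split=> //; last first.
    by move=> y; apply: (G'close y 1 w); rewrite ?ler01 // phiE.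
  apply/seteqP; split=> // z [[y _ <-] [x _ xy]].
  have [[_ nZ] [N HN]] := koff y.
  have [Bx|nBx] := pselect (B x).
    apply: nZ; exists (f x); first exact: ZB.
    by rewrite -/(k y) -phiE -xy gB.
  have [_ [M HM]] := hnB x nBx.
  have [i [+ wi ci]] := w_zero (maxn N M); rewrite geq_max => /andP[Ni Mi].
  by apply: wi; rewrite -HN // -/(k y) -phiE -xy gE HM // ci.
- move=> x; case/andP: (beta01 x) => b0 b1.
  by apply: (Gclose (f x) (beta x) (c (j x))) => //; rewrite gE.
- by move=> x nB; rewrite gE; case: (hnB x nB).
Qed.

End universal_map.

(** The [i]-th coordinate is raised to at least half the cover radius; altering one coordinate does
    not lead out of [Y]. *)
Lemma coordinate_hyperplane_Z_set (A : set Y) i :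
  closed A -> (forall y, A y -> co (io y) i = 0) -> Z_set A.
Proof.
move=> cA A0; split=> // U Uc.
have [eps [eps01 epsl eps0 epsU]] := cover_radius emb Uc.
have epsc : continuous eps := lip_continuous epsl.
pose k y : Q := mkQ (fun l => if l == i then Num.max (co (io y) i) (eps (io y) / 2)
                            else co (io y) l).
have cok y l : co (k y) l = if l == i then Num.max (co (io y) i) (eps (io y) / 2)
                            else co (io y) l.
  rewrite co_mkQ //; case: eqP => _; last exact: co_itv.
  rewrite le_max co_ge0 /= ge_max co_le1 /=.
  by have /andP[] := eps01 (io y); lra.
have kc : continuous k.
  apply/continuousQP => l y.
  have coc m : (fun z => co (io z) m) @ y --> co (io y) m.
    exact: (cvg_map (emb_continuous emb (x := y)) (@co_continuous R m)).
  rewrite (_ : (fun z => co (k z) l) =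
    fun z => if l == i then Num.max (co (io z) i) (eps (io z) / 2) else co (io z) l);
    last by apply/funext => z; rewrite cok.
  rewrite /continuous_at /=; case: eqP => _; last exact: coc.
  apply: max_cvg; first exact: coc.
  apply: cvgM; last exact: cvg_cst.
  exact: (cvg_map (emb_continuous emb (x := y)) epsc).
have kE y : range io (k y).
  apply: (tail_ideal_tail Eideal (a := io y)); first by exists y.
  by exists i.+1 => l il; rewrite cok gtn_eqF.
have [g gc gE] := lift_through emb kc kE.
exists g; split=> //.
  apply/seteqP; split=> // z [[y _ <-]] /A0.
  rewrite gE cok eqxx => m0; have := eps0 y.
  have : eps (io y) / 2 <= 0 by rewrite -m0 le_max lexx orbT.
  by lra.
move=> y; apply: epsU; rewrite gE; have e0 := eps0 y.
apply: le_lt_trans (_ : eps (io y) / 2 < _); last by lra.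
apply: dQ_le => l; rewrite cok; case: eqP => [->|_]; last first.
  by rewrite subrr normr0 mulr0; lra.
rewrite -[leRHS]mul1r; apply: ler_pM => //; first exact: (ltW (e2_gt0 _)).
  exact: e2_le1.
have c0 := co_ge0 (io y) i.
by rewrite ler_norml maxElt; case: ifP => h; apply/andP; split; lra.
Qed.

End universality.

(** * Absolute Borel classes *)

Section ultrafilters_and_closure.

Lemma closure_range_ultra (T : topologicalType) (I : Type) (h : I -> T) (p : T) :
  closure (range h) p -> exists2 F : set_system I, UltraFilter F & h @ F --> p.
Proof.
move=> cp; pose F0 : set_system I := filter_from (nbhs p) (fun V => h @^-1` V).
have F0P : ProperFilter F0.
  apply: filter_from_proper => [|V nV]; last first.
    by have [_ [[x _ <-] Vx]] := cp V nV; exists x.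
  apply: filter_from_filter; first by exists setT; exact: filterT.
  by move=> V W nV nW; exists (V `&` W) => //; exact: filterI.
have [F [FU F0F]] := ultraFilterLemma F0P.
by exists F => // V nV; apply: F0F; exists V.
Qed.

Lemma closed_cvg_mem (T : topologicalType) (I : Type) (F : set_system I)
    (h : I -> T) (p : T) (S : set T) :
  ProperFilter F -> closed S -> h @ F --> p -> (forall x, S (h x)) -> S p.
Proof.
move=> FF cS hp hS; apply: cS => V nV.
have FV : F (h @^-1` V) by exact: hp.
by have [x Vx] := filter_ex FV; exists (h x).
Qed.

Lemma fst_continuous (X Y : topologicalType) : continuous (@fst X Y).
Proof. by move=> p; exact: cvg_fst. Qed.

Lemma snd_continuous (X Y : topologicalType) : continuous (@snd X Y).
Proof. by move=> p; exact: cvg_snd. Qed.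

(** An ultrafilter on [S] whose second component tends to [y] has a limit in the compact first
    component too. *)
Lemma closed_projection (K Y : topologicalType) (S : set (K * Y)) :
  compact [set: K] -> closed S -> closed [set y | exists k, S (k, y)].
Proof.
move=> Kc cS y cy; pose I := {x : K * Y | S x}.
have : closure (range (fun x : I => (sval x).2)) y.
  apply: closure_subset cy => z [k Skz].
  by exists (exist _ (k, z) Skz).
move=> /closure_range_ultra[F FU Fy].
have [k Fk] := compact_ultra_cvg (fun x : I => (sval x).1) Kc FU.
exists k; have FF : ProperFilter F by exact: ultra_proper.
apply: (closed_cvg_mem (h := fun x : I => sval x) FF cS) => [|x]; last exact: svalP.
rewrite (_ : (fun x : I => sval x) = fun x => ((sval x).1, (sval x).2)); last first.
  by apply/funext => -[[]].
exact: cvg_pair Fk Fy.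
Qed.

End ultrafilters_and_closure.

Section Borel_classes.
Context {Y : topologicalType}.
Implicit Types (S : set Y).

Lemma Fsigma_bigcup (S : nat -> set Y) :
  (forall n, Fsigma (S n)) -> Fsigma (\bigcup_n S n).
Proof.
move=> SF; have /choice[F FP] : forall n, exists F : nat -> set Y,
    (forall i, closed (F i)) /\ S n = \bigcup_i F i.
  by move=> n; have [F cF SE] := SF n; exists F.
exists (fun k => if unpickle k is Some (n, i) then F n i else set0).
  move=> k; case: (unpickle k) => [[n i]|]; last exact: closed0.
  exact: (FP n).1.
apply/seteqP; split=> [y [n _]|y [k _]].
  by rewrite (FP n).2 => -[i _ Fy]; exists (pickle (n, i)); rewrite ?pickleK.
by case: (unpickle k) => [[n i]|//] Fy; exists n => //; rewrite (FP n).2; exists i.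
Qed.

Lemma Fsigmadelta_bigcap (S : nat -> set Y) :
  (forall n, Fsigmadelta (S n)) -> Fsigmadelta (\bigcap_n S n).
Proof.
move=> SF; have /choice[F FP] : forall n, exists F : nat -> set Y,
    (forall i, Fsigma (F i)) /\ S n = \bigcap_i F i.
  by move=> n; have [F cF SE] := SF n; exists F.
exists (fun k => if unpickle k is Some (n, i) then F n i else setT).
  move=> k; case: (unpickle k) => [[n i]|]; last by apply: closed_Fsigma; exact: closedT.
  exact: (FP n).1.
apply/seteqP; split=> [y Sy k _|y H n _].
  by case: (unpickle k) => [[n i]|//]; have := Sy n I; rewrite (FP n).2; exact.
by rewrite (FP n).2 => i _; have := H (pickle (n, i)) I; rewrite pickleK.
Qed.

Lemma Fsigma_Fsigmadelta S : Fsigma S -> Fsigmadelta S.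
Proof. by move=> SF; exists (fun=> S) => //; rewrite bigcap_const. Qed.

Lemma Fsigmadelta_Fsigmadeltasigma S : Fsigmadelta S -> Fsigmadeltasigma S.
Proof. by move=> SF; exists (fun=> S) => //; rewrite bigcup_const. Qed.

Lemma Fsigmadelta_setI S T :
  Fsigmadelta S -> Fsigmadelta T -> Fsigmadelta (S `&` T).
Proof.
move=> FS FT; rewrite (_ : S `&` T = \bigcap_n (if n == 0%N then S else T)).
  by apply: Fsigmadelta_bigcap => n; case: ifP.
apply/seteqP; split=> [y [Sy Ty] n _|y H]; first by case: ifP.
by split; [exact: (H 0%N I) | exact: (H 1%N I)].
Qed.

Lemma Fsigmadeltasigma_setI S T :
  Fsigmadeltasigma S -> Fsigmadelta T -> Fsigmadeltasigma (S `&` T).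
Proof.
move=> [F FF ->] FT; exists (fun n => F n `&` T); last by rewrite setI_bigcupl.
by move=> n; exact: Fsigmadelta_setI.
Qed.

Context {R : realType} {jY : Y -> hilbert_cube R} (embY : top_embedding jY).

(** The closed pieces consist of the points at distance at least [2^-n] from the complement. *)
Lemma open_Fsigma (U : set Y) : open U -> Fsigma U.
Proof.
move=> oU; pose D y := dset (@dQ R) (jY @` (~` U)) (jY y).
have Dc : continuous D.
  by move=> y; exact: (cvg_map (emb_continuous embY (x := y)) (@dsetQ_continuous R _)).
exists (fun n => D @^-1` [set r | (2^-1) ^+ n <= r]).
  move=> n; apply: preimage_closed => //; exact: closed_ge.
apply/seteqP; split=> [y Uy|y [n _ /= Dy]].
  have D0 : 0 < D y.
    by apply: (emb_dset_gt0 embY); [exact: open_closedC | exact].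
  by have [n /ltW Dn] := e2_small D0; exists n.
apply: contrapT => nUy; move: Dy; rewrite /D (dset_eq0 dQ_pdist); last by exists y.
by rewrite leNgt e2_gt0.
Qed.

End Borel_classes.

(* The embeddings [io] and [e] are compared through the closure [Gr] of the set
   of pairs [(io a, e a)]: as [Q] is compact, the set [T] of points [y] having at
   most one [p] with [Gr (p, y)] is a G_delta set, and [Gr] transports
   F_sigma-delta sets of [Q] to F_sigma-delta sets of [T]. *)
Section Lavrentiev.
Context {R : realType}.
Notation Q := (hilbert_cube R).
Context {A Y : topologicalType} {io : A -> Q} {e : A -> Y} {jY : Y -> Q}.
Hypotheses (emb_io : top_embedding io) (emb_e : top_embedding e).
Hypothesis emb_jY : top_embedding jY.

Let Gr : set (Q * Y) := closure (range (fun a => (io a, e a))).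

Let GrP p y : Gr (p, y) -> exists2 F : set_system A, UltraFilter F &
  io @ F --> p /\ e @ F --> y.
Proof.
move=> /closure_range_ultra[F FU Fpy]; exists F => //.
have FF : ProperFilter F by exact: ultra_proper.
split.
  exact: (cvg_map Fpy (@fst_continuous _ _)).
exact: (cvg_map Fpy (@snd_continuous _ _)).
Qed.

Let Gr_graph a : Gr (io a, e a).
Proof. by apply: subset_closure; exists a. Qed.

(** Along an ultrafilter [io] tends to [io a] only if the ultrafilter converges to [a], and then [e]
    tends to [e a]; the closure adds nothing over [io a]. *)
Let Gr_io a y : Gr (io a, y) -> y = e a.
Proof.
move=> /GrP[F FU [Fio Fe]]; have FF : ProperFilter F by exact: ultra_proper.
have FF' : Filter F by exact: filter_filter.
have Fa : (id : A -> A) @ F --> a.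
  by apply/(@emb_cvg R A io emb_io A F FF').
have [ec _ _] := emb_e.
have F1 := cvg_map (FF := FF') Fe (emb_continuous emb_jY).
have F2 := cvg_map (FF := FF') (cvg_map (FF := FF') Fa ec) (emb_continuous emb_jY).
exact: (emb_inj emb_jY (cvg_unique (@Q_hausdorff R) F1 F2)).
Qed.

Let Gr_e a p : Gr (p, e a) -> p = io a.
Proof.
move=> /GrP[F FU [Fio Fe]]; have FF : ProperFilter F by exact: ultra_proper.
apply: (cvg_unique (@Q_hausdorff R) Fio).
have Fa : (id : A -> A) @ F --> a by apply/(embedding_cvg id a emb_e).
exact: (cvg_map Fa (emb_continuous emb_io)).
Qed.

Let T := [set y | forall p q, Gr (p, y) -> Gr (q, y) -> p = q].

Let T_Fsigmadelta : Fsigmadelta T.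
Proof.
(* Two points over the same [y] at distance at least [2^-n]. The set is closed, so is its projection
   along the compact [Q * Q], and [T] is what avoids all these projections. *)
pose S n := [set x : (Q * Q) * Y |
  [/\ Gr (x.1.1, x.2), Gr (x.1.2, x.2) & (2^-1) ^+ n <= dQ x.1.1 x.1.2]].
have cS n : closed (S n).
  move=> x cx; have : closure (range (fun z : {x | S n x} => sval z)) x.
    by apply: closure_subset cx => z Sz; exists (exist _ z Sz).
  move=> /closure_range_ultra[F FU Fx].
  have FF : ProperFilter F by exact: ultra_proper.
  have FF' : Filter F by exact: filter_filter.
  have F1 := cvg_map (FF := FF') Fx (@fst_continuous _ _).
  have F2 := cvg_map (FF := FF') Fx (@snd_continuous _ _).
  have F11 := cvg_map (FF := FF') F1 (@fst_continuous _ _).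
  have F12 := cvg_map (FF := FF') F1 (@snd_continuous _ _).
  have cG : closed Gr by exact: closed_closure.
  split.
  - apply: (@closed_cvg_mem _ _ F (fun z => ((sval z).1.1, (sval z).2)) _ Gr) => //.
      exact: cvg_pair F11 F2.
    by move=> [z []].
  - apply: (@closed_cvg_mem _ _ F (fun z => ((sval z).1.2, (sval z).2)) _ Gr) => //.
      exact: cvg_pair F12 F2.
    by move=> [z []].
  rewrite leNgt; apply/negP => lt; set r := (2^-1) ^+ n - dQ x.1.1 x.1.2.
  have r0 : 0 < r / 2 by rewrite divr_gt0 // subr_gt0.
  have N1 := proj1 (@cvgQ_dist R _ F FF' _ _) F11 _ r0.
  have N2 := proj1 (@cvgQ_dist R _ F FF' _ _) F12 _ r0.
  have [[z [/= _ _ Sz]] /= [h1 h2]] := @filter_ex _ F FF _ (@filterI _ F FF' _ _ N1 N2).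
  have h3 := dQ_triangle x.1.1 z.1.1 z.1.2.
  have h4 := dQ_triangle x.1.2 x.1.1 z.1.2.
  by rewrite (dQ_sym z.1.1 x.1.1) in h3; rewrite /r in h1 h2; lra.
have QQc : compact [set: Q * Q].
  by rewrite -setXTT; apply: compact_setX; exact: Q_compact.
rewrite (_ : T = \bigcap_n (~` [set y | exists k, S n (k, y)])).
  apply: Fsigmadelta_bigcap => n; apply: Fsigma_Fsigmadelta.
  apply: (open_Fsigma emb_jY); apply: closed_openC; exact: closed_projection.
apply/seteqP; split=> [y Ty n _ [[p q] [/= Gp Gq]]|y H p q Gp Gq].
  by rewrite (Ty p q Gp Gq) dQxx leNgt e2_gt0.
apply: dQ_eq0; apply/eqP; rewrite eq_le dQ_ge0 andbT leNgt; apply/negP => d0.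
have [n /ltW dn] := e2_small d0.
by apply: (H n I); exists (p, q).
Qed.

Let pull (S : set Q) := [set y | T y /\ exists p, Gr (p, y) /\ S p].

(** Over [T] the point [p] is unique, so a countable intersection can be tested one set at a time;
    closed sets go to closed sets by projection along [Q]. *)
Let pull_Fsigmadelta S : Fsigmadelta S -> Fsigmadelta (pull S).
Proof.
move=> [F FF ->]; have /choice[C CP] : forall i, exists C : nat -> set Q,
    (forall k, closed (C k)) /\ F i = \bigcup_k C k.
  by move=> i; have [C cC FE] := FF i; exists C.
pose P i k := [set y | exists p, (Gr `&` (C i k `*` setT)) (p, y)].
have cP i k : closed (P i k).
  apply: closed_projection; first exact: Q_compact.
  apply: closedI; first exact: closed_closure.
  rewrite (_ : _ `*` _ = fst @^-1` C i k).
    exact: (proj1 (continuous_closedP _) (@fst_continuous Q Y) _ ((CP i).1 k)).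
  by apply/seteqP; split=> [z []|z].
rewrite (_ : pull _ = T `&` \bigcap_i \bigcup_k P i k).
  apply: Fsigmadelta_setI; first exact: T_Fsigmadelta.
  apply: Fsigmadelta_bigcap => i.
  by apply: Fsigma_Fsigmadelta; exists (P i).
apply/seteqP; split=> [y [Ty [p [Gp Fp]]]|y [Ty H]].
  split=> // i _; have := Fp i I; rewrite (CP i).2 => -[k _ Cp].
  by exists k => //; exists p.
split=> //; have [k0 _ [p [Gp _]]] := H 0%N I.
exists p; split=> // i _; have [k _ [q [Gq [Cq _]]]] := H i I.
by rewrite (Ty p q Gp Gq) (CP i).2; exists k.
Qed.

Let pull_range : pull (range io) = range e.
Proof.
apply/seteqP; split=> [y [Ty [p [Gp [a _ pa]]]]|_ [a _ <-]].
  by exists a => //; rewrite -pa in Gp; rewrite (Gr_io Gp).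
split; last by exists (io a); split; [exact: Gr_graph | exists a].
by move=> p q /Gr_e -> /Gr_e ->.
Qed.

Lemma Fsigmadelta_absolute : Fsigmadelta (range io) -> Fsigmadelta (range e).
Proof. by move=> /pull_Fsigmadelta; rewrite pull_range. Qed.

Lemma Fsigmadeltasigma_absolute :
  Fsigmadeltasigma (range io) -> Fsigmadeltasigma (range e).
Proof.
move=> [F FF FE]; exists (fun k => pull (F k)).
  by move=> k; exact: pull_Fsigmadelta.
rewrite -pull_range FE; apply/seteqP; split=> [y [Ty [p [Gp [k _ Fp]]]]|y [k _]].
  by exists k => //; split=> //; exists p.
by move=> [Ty [p [Gp Fp]]]; split=> //; exists p; split=> //; exists k.
Qed.

End Lavrentiev.

(** * Reductions to Pi_3 and Sigma_4 *)

Section columns.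

Lemma logn_column n m : logn 2 (2 ^ n * (2 * m + 1)) = n.
Proof.
rewrite lognM ?expn_gt0 ?addn1 // lognX logn_prime // eqxx muln1.
by rewrite logn_coprime ?addn0 // coprime2n /= oddM.
Qed.

(** With [logn 2 i] as the column [n], this recovers [m] from [i = 2 ^ n * (2 * m + 1)]. *)
Definition row (i : nat) : nat := (i %/ 2 ^ logn 2 i)./2.

Lemma row_column n m : row (2 ^ n * (2 * m + 1)) = m.
Proof.
rewrite /row logn_column mulKn ?expn_gt0 // addn1 mul2n.
by rewrite -[in RHS](uphalf_double m) uphalfE.
Qed.

Lemma column_ge n m : (m <= 2 ^ n * (2 * m + 1))%N.
Proof.
have : (0 < 2 ^ n)%N by rewrite expn_gt0.
by move: (2 ^ n)%N => a; nia.
Qed.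

Lemma column_ge_col n m : (n <= 2 ^ n * (2 * m + 1))%N.
Proof.
have : (n < 2 ^ n)%N by rewrite ltn_expl.
by move: (2 ^ n)%N => a; nia.
Qed.

End columns.

Section tail_ideals.
Context {R : realType}.
Notation Q := (hilbert_cube R).

Let co0 i : co (mkQ (fun=> 0) : Q) i = 0.
Proof. by rewrite co_mkQ // lexx ler01. Qed.

Lemma Pi3P (p : Q) : Pi3 R p <->
  forall n, exists k, forall m, (k <= m)%N -> co p (2 ^ n * (2 * m + 1)) = 0.
Proof. by []. Qed.

Lemma Sigma4P (p : Q) : Sigma4 R p <->
  exists n0, forall n, (n0 <= n)%N ->
    exists k, forall m, (k <= m)%N -> co p (2 ^ n * (2 * m + 1)) = 0.
Proof. by []. Qed.

Lemma Pi3_tail_ideal : tail_ideal (Pi3 R).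
Proof.
split; first by apply/Pi3P => n; exists 0%N => m _; exact: co0.
move=> a b z /Pi3P aP /Pi3P bP [N HN]; apply/Pi3P => n.
have [k kP] := aP n; have [l lP] := bP n; exists (maxn N (maxn k l)) => m.
rewrite !geq_max => /and3P[Nm km lm]; apply: HN; [|exact: kP|exact: lP].
exact: leq_trans Nm (column_ge _ _).
Qed.

Lemma Sigma4_tail_ideal : tail_ideal (Sigma4 R).
Proof.
split; first by apply/Sigma4P; exists 0%N => n _; exists 0%N => m _; exact: co0.
move=> a b z /Sigma4P[na aP] /Sigma4P[nb bP] [N HN]; apply/Sigma4P.
exists (maxn na nb) => n; rewrite geq_max => /andP[/aP[k kP] /bP[l lP]].
exists (maxn N (maxn k l)) => m.
rewrite !geq_max => /and3P[Nm km lm]; apply: HN; [|exact: kP|exact: lP].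
exact: leq_trans Nm (column_ge _ _).
Qed.

Lemma Pi3_sub_Sigma4 : Pi3 R `<=` Sigma4 R.
Proof. by move=> p pP; exists 0%N => n _; exact: pP. Qed.

Lemma Sigma4_zero (p : Q) : Sigma4 R p -> exists i, co p i = 0.
Proof.
move=> /Sigma4P[n nP]; have [k kP] := nP n (leqnn n).
by exists (2 ^ n * (2 * k + 1))%N; exact: kP.
Qed.

Lemma Pi3_zero (p : Q) : Pi3 R p -> exists i, co p i = 0.
Proof. by move=> /Pi3_sub_Sigma4; exact: Sigma4_zero. Qed.

End tail_ideals.

Section coding.
Context {R : realType}.
Notation Q := (hilbert_cube R).

(** A point of Pi_3 that is nonzero at entry 1 of every column, exactly where every code vanishes;
    it serves as [w] in [universal_map]. *)
Definition spike : Q := mkQ (fun i => if row i == 1%N then 1 else 0).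

Lemma co_spike n m :
  co spike (2 ^ n * (2 * m + 1)) = if m == 1%N then 1 else 0.
Proof.
by rewrite co_mkQ row_column //; case: ifP => _; rewrite lexx ler01.
Qed.

Lemma spike_Pi3 : Pi3 R spike.
Proof. by apply/Pi3P => n; exists 2%N => m m2; rewrite co_spike gtn_eqF. Qed.

(* In the [n]-th column, the entry 0 is a coordinate of [p], chosen so that each
   coordinate occurs in infinitely many columns, the entry 1 is 0, and the other
   entries vanish when [p] belongs to the closed sets [F n m]. *)
Definition code (F : nat -> nat -> set Q) (p : Q) : Q :=
  mkQ (fun i => if row i == 0%N then co p (logn 2 (logn 2 i))
                else if row i == 1%N then 0
                else dset (@dQ R) (F (logn 2 i) (row i)) p).

Lemma co_code F p i :
  co (code F p) i = if row i == 0%N then co p (logn 2 (logn 2 i))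
                    else if row i == 1%N then 0
                    else dset (@dQ R) (F (logn 2 i) (row i)) p.
Proof.
rewrite co_mkQ //; case: ifP => _; first exact: co_itv.
case: ifP => _; first by rewrite lexx ler01.
by rewrite (dset_ge0 dQ_pdist) (dset_le1 dQ_pdist).
Qed.

Lemma code_continuous F : continuous (code F).
Proof.
apply/continuousQP => i.
rewrite (_ : (fun x => _) = fun p => if row i == 0%N then co p (logn 2 (logn 2 i))
  else if row i == 1%N then 0 else dset (@dQ R) (F (logn 2 i) (row i)) p); last first.
  by apply/funext => p; rewrite co_code.
case: (row i == 0%N); first exact: co_continuous.
case: (row i == 1%N); first exact: (@cst_continuous Q R 0).
exact: dsetQ_continuous.
Qed.

Lemma code_column F p n : (forall k, closed (F n k)) ->
  (forall k l, (k <= l)%N -> F n k `<=` F n l) ->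
  (exists k, forall m, (k <= m)%N -> co (code F p) (2 ^ n * (2 * m + 1)) = 0) <->
  exists k, F n k p.
Proof.
move=> cF iF; split=> [[k kP]|[k Fk]].
  (* The shift by 2 skips the entries 0 and 1, which are not distances. *)
  exists k.+2; have := kP k.+2 (leqW (leqnSn k)).
  by rewrite co_code row_column logn_column /=; exact: dsetQ_closed.
exists k.+2 => m km; rewrite co_code row_column logn_column.
have km' : (k <= m)%N by lia.
case: eqP => [|_]; first by lia.
case: eqP => [|_]; first by lia.
by apply: (dset_eq0 dQ_pdist); exact: iF Fk.
Qed.

Lemma code_separates F (p q : Q) : p <> q ->
  forall N, exists2 i, (N <= i)%N & co (code F p) i <> co (code F q) i.
Proof.
move=> pq N; have [k kP] : exists k, co p k <> co q k.
  by apply: contrapT => H; apply: pq; apply: co_inj => i; apply: contrapT => ne;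
    apply: H; exists i.
(* Since [logn 2 n = k], entry 0 of column [n] is the coordinate [k]; the factor with [N] puts it
   beyond index [N]. *)
pose n := (2 ^ k * (2 * N + 1))%N.
exists (2 ^ n * (2 * 0 + 1))%N.
  exact: leq_trans (column_ge k N) (column_ge_col _ _).
by rewrite !co_code row_column logn_column eqxx /n logn_column.
Qed.

Lemma code_spike F N : exists i,
  [/\ (N <= i)%N, co spike i <> 0 & forall p, co (code F p) i = 0].
Proof.
exists (2 ^ N * (2 * 1 + 1))%N; split; first exact: column_ge_col.
  by rewrite co_spike eqxx; apply/eqP; exact: oner_neq0.
by move=> p; rewrite co_code row_column.
Qed.

Lemma Fsigma_increasing (T : topologicalType) (S : set T) : Fsigma S ->
  exists F : nat -> set T, [/\ forall k, closed (F k),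
    forall k l, (k <= l)%N -> F k `<=` F l & forall x, S x <-> exists k, F k x].
Proof.
move=> [F cF ->]; exists (fun k => \bigcup_(l < k.+1) F l); split.
- by move=> k; apply: closed_bigcup => // l _; exact: cF.
- by move=> k l kl x [i /= ik Fi]; exists i => //=; exact: leq_trans kl.
- by move=> x; split=> [[k _ Fk]|[k [l _ Fl]]]; [exists k, k => //= | exists l].
Qed.

Lemma Pi3_code (S : set Q) : Fsigmadelta S ->
  exists F, forall p, Pi3 R (code F p) <-> S p.
Proof.
move=> [E EF ->]; have /choice[F FP] := fun n => Fsigma_increasing (EF n).
exists F => p; rewrite Pi3P; split=> [H n _|H n].
  by have [cF iF EE] := FP n; apply/EE; apply/(code_column p cF iF); exact: H.
by have [cF iF EE] := FP n; apply/(code_column p cF iF); apply/EE; exact: H.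
Qed.

End coding.

(** * F_sigma-delta-sigma sets as lower limits of F_sigma sets *)

Section eventually_Fsigma.

Lemma injective_unbounded (f : nat -> nat) : injective f ->
  forall N, exists r, (N <= f r)%N.
Proof.
move=> fi N; apply: contrapT => H.
have fN r : (f r < N)%N by rewrite ltnNge; apply/negP => h; apply: H; exists r.
pose g (r : 'I_N.+1) : 'I_N := Ordinal (fN r).
have gi : injective g by move=> r s /(congr1 val) /= /fi rs; exact: val_inj.
by have := leq_card g gi; rewrite !card_ord ltnn.
Qed.

Lemma ex_least (P : nat -> Prop) : (exists n, P n) ->
  exists2 n, P n & forall m, (m < n)%N -> ~ P m.
Proof.
move=> [n Pn]; have exP : exists n, `[< P n >] by exists n; apply/asboolP.
exists (ex_minn exP); first by case: ex_minnP => m /asboolP.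
move=> m; case: ex_minnP => l _ lP ml Pm.
by have := lP m (asboolT Pm); rewrite leqNgt ml.
Qed.

Context {R : realType} {Y : topologicalType} {jY : Y -> hilbert_cube R}.
Hypothesis embY : top_embedding jY.

Lemma Fsigma_ex (S : nat -> set Y) : (forall n, Fsigma (S n)) ->
  Fsigma [set y | exists n, S n y].
Proof.
move=> SF; rewrite (_ : [set y | _] = \bigcup_n S n); first exact: Fsigma_bigcup.
by apply/seteqP; split=> [y [n Sn]|y [n _ Sn]]; exists n.
Qed.

Lemma Fsigma_if (P : Prop) (S : set Y) : (P -> Fsigma S) ->
  Fsigma [set y | P /\ S y].
Proof.
move=> SF; have [HP|nP] := pselect P.
  rewrite (_ : [set y | _] = S); first exact: SF.
  by apply/seteqP; split=> [y []|y].
rewrite (_ : [set y | _] = set0); first by apply: closed_Fsigma; exact: closed0.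
by apply/seteqP; split=> [y []|y].
Qed.

Lemma Fsigma_setU (S T : set Y) : Fsigma S -> Fsigma T ->
  Fsigma [set y | S y \/ T y].
Proof.
move=> FS FT; rewrite (_ : [set y | _] = [set y | exists n, (if n == 0%N then S else T) y]).
  by apply: Fsigma_ex => n; case: ifP.
apply/seteqP; split=> [y [Sy|Ty]|y [n]]; first by exists 0%N.
  by exists 1%N.
by case: ifP => _; [left|right].
Qed.

(* Write [S] as the union over [k] of the sets [\bigcap_l \bigcup_m C k l m].
   A point outside [S] has, for every [k], a unique finite sequence [s] whose size
   is the least [l] such that the point lies in no [C k l m] and whose
   entries are the least witnesses for the smaller [l]. As there is exactly one such [s]
   for every [k], a point lies outside [S] iff infinitely many finite sequences
   of such [s] are correct up to their length. *)
Lemma Fsigmadeltasigma_eventually (S : set Y) : Fsigmadeltasigma S ->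
  exists E : nat -> set Y, (forall n, Fsigma (E n)) /\
    forall y, S y <-> exists n0, forall n, (n0 <= n)%N -> E n y.
Proof.
move=> [G GF ->].
have /choice[D DP] : forall k, exists D : nat -> set Y,
    (forall l, Fsigma (D l)) /\ G k = \bigcap_l D l.
  by move=> k; have [D DF GE] := GF k; exists D.
have /choice[C CP] : forall k, exists C : nat -> nat -> set Y,
    forall l, (forall m, closed (C l m)) /\ D k l = \bigcup_m C l m.
  move=> k; have /choice[c cP] : forall l, exists c : nat -> set Y,
      (forall m, closed (c m)) /\ D k l = \bigcup_m c m.
    by move=> l; have [c cc DE] := (DP k).1 l; exists c.
  by exists c.
have GE k y : G k y <-> forall l, exists m, C k l m y.
  rewrite (DP k).2; split=> [H l|H l _].
    by have := H l I; rewrite (CP k l).2 => -[m _ ?]; exists m.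
  by rewrite (CP k l).2; have [m ?] := H l; exists m.
pose W k (s : seq nat) y := (forall m, ~ C k (size s) m y) /\
  forall l, (l < size s)%N -> C k l (nth 0%N s l) y /\
    forall m, (m < nth 0%N s l)%N -> ~ C k l m y.
have W_size k s t y : W k s y -> W k t y -> (size t <= size s)%N.
  move=> [Ws _] [_ Wt]; rewrite leqNgt; apply/negP => st.
  by have [+ _] := Wt _ st; exact: Ws.
have W_inj k s t y : W k s y -> W k t y -> s = t.
  move=> Ws Wt; have sz : size s = size t.
    by apply/eqP; rewrite eqn_leq (W_size k t s y) // (W_size k s t y).
  apply: (@eq_from_nth _ 0%N) => // l ls; have [_ /(_ l ls)[Cs Ms]] := Ws.
  have [_ /(_ l)] := Wt; rewrite -sz => /(_ ls)[Ct Mt].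
  have [lt|lt|//] := ltngtP (nth 0%N s l) (nth 0%N t l).
    by case: (Mt _ lt).
  by case: (Ms _ lt).
have W_ex k y : ~ G k y -> exists s, W k s y.
  move=> nG; have [|l lP lmin] := @ex_least (fun l => forall m, ~ C k l m y).
    apply: contrapT => H; apply: nG; apply/GE => l; apply: contrapT => Hl.
    by apply: H; exists l => m Cm; apply: Hl; exists m.
  have /choice[mu muP] : forall l', exists m, (l' < l)%N ->
      C k l' m y /\ forall m', (m' < m)%N -> ~ C k l' m' y.
    move=> l'; have [ll|nll] := boolP (l' < l)%N; last by exists 0%N.
    have [|m Cm mm] := @ex_least (fun m => C k l' m y); last by exists m.
    apply: contrapT => H; apply: (lmin l' ll) => m Cm.
    by apply: H; exists m.
  exists (mkseq mu l); split=> [m|l']; rewrite size_mkseq; first exact: lP.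
  by move=> ll; rewrite nth_mkseq //; exact: muP.
have W_G k s y : W k s y -> ~ G k y.
  by move=> [Ws _] /GE /(_ (size s))[m]; exact: Ws.
pose V (ss : seq (seq nat)) y :=
  forall k, (k < size ss)%N -> W k (nth [::] ss k) y.
(* The points at which the sequence coded by [n] is incorrect; the whole space if [n] codes none. *)
pose E n := [set y | forall ss, pickle ss = n -> ~ V ss y].
exists E; split.
  move=> n; have [[ss ssn]|nss] := pselect (exists ss : seq (seq nat), pickle ss = n).
    (* Incorrectness is a countable disjunction of closed conditions and of negated ones, which are
       open and hence F_sigma. *)
    rewrite (_ : E n = [set y | exists k, (k < size ss)%N /\
      let s := nth [::] ss k in
      ((exists m, C k (size s) m y) \/
       (exists l, (l < size s)%N /\ ((~` C k l (nth 0%N s l)) y \/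
          (exists m, (m < nth 0%N s l)%N /\ C k l m y))))]).
      apply: Fsigma_ex => k; apply: Fsigma_if => _.
      apply: Fsigma_setU.
        by apply: Fsigma_ex => m; apply: closed_Fsigma; exact: (CP k _).1.
      apply: Fsigma_ex => l; apply: Fsigma_if => _; apply: Fsigma_setU.
        by apply: (open_Fsigma embY); apply: closed_openC; exact: (CP k l).1.
      apply: Fsigma_ex => m; apply: Fsigma_if => _.
      by apply: closed_Fsigma; exact: (CP k l).1.
    apply/seteqP; split=> [y Ey|y [k [kss H]] tt ttn VV].
      apply: contrapT => H; apply: (Ey ss ssn) => k kss; split=> [m Cm|l ls].
        by apply: H; exists k; split=> //; left; exists m.
      split=> [|m ml Cm].
        apply: contrapT => nC; apply: H; exists k; split=> //; right.
        by exists l; split=> //; left.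
      apply: H; exists k; split=> //; right; exists l; split=> //.
      by right; exists m.
    have Et : tt = ss by apply: (pcan_inj pickleK); rewrite ttn ssn.
    rewrite Et in VV; have [W1 W2] := VV k kss.
    case: H => [[m /W1]//|[l [ls [nC|[m [ml Cm]]]]]].
      by have [/nC] := W2 l ls.
    by have [_ /(_ m ml)] := W2 l ls.
  rewrite (_ : E n = setT); first by apply: closed_Fsigma; exact: closedT.
  by apply/seteqP; split=> // y _ ss ssn; case: nss; exists ss.
move=> y; split=> [[k0 _ Gk]|[n0 H]].
  (* For [y] in [G k0] a correct sequence has length at most [k0], and each length [r] admits at
     most one, [f r]; the bound exceeds all their codes. *)
  have /choice[f fP] : forall r, exists tt, forall ss,
      size ss = r -> V ss y -> ss = tt.
    move=> r; have [[ss [ssr Vs]]|H] := pselect (exists ss, size ss = r /\ V ss y).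
      exists ss => tt ttr Vt; apply: (@eq_from_nth _ [::]); first by rewrite ttr ssr.
      by move=> k kt; apply: (W_inj k _ _ y); [exact: Vt | apply: Vs; rewrite ssr -ttr].
    by exists [::] => ss ssr Vs; case: H; exists ss.
  exists (\max_(r < k0.+1) (pickle (f r)).+1) => n n0n ss ssn Vs.
  have sz : (size ss < k0.+1)%N.
    by rewrite ltnS leqNgt; apply/negP => /Vs /W_G.
  have /= := @leq_bigmax _ (fun r : 'I_k0.+1 => (pickle (f r)).+1) (Ordinal sz).
  rewrite -(fP _ ss erefl Vs) ssn => h.
  by have := leq_trans h n0n; rewrite ltnn.
apply: contrapT => nS.
have /choice[s sP] : forall k, exists s, W k s y.
  by move=> k; apply: W_ex => Gk; apply: nS; exists k.
(* The correct initial segments have distinct lengths, hence unbounded codes, so [E n] fails at [y]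
   for some [n >= n0]. *)
have [|r n0r] := @injective_unbounded (fun r => pickle (mkseq s r)) _ n0.
  by move=> r r' /(pcan_inj pickleK) /(congr1 size); rewrite !size_mkseq.
apply: (H _ n0r (mkseq s r) erefl) => k; rewrite size_mkseq => kr.
by rewrite nth_mkseq //; exact: sP.
Qed.

End eventually_Fsigma.

Lemma Sigma4_code (R : realType) (S : set (hilbert_cube R)) : Fsigmadeltasigma S ->
  exists F, forall p, Sigma4 R (code F p) <-> S p.
Proof.
move=> /(Fsigmadeltasigma_eventually (@id_embedding _))[E [EF SE]].
have /choice[F FP] := fun n => Fsigma_increasing (EF n).
exists F => p; rewrite Sigma4P SE; split=> -[n0 H]; exists n0 => n n0n.
  by have [cF iF EE] := FP n; apply/EE; apply/(code_column p cF iF); exact: H.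
by have [cF iF EE] := FP n; apply/(code_column p cF iF); apply/EE; exact: H.
Qed.

Section Borel_ranks.
Context {R : realType}.
Notation Q := (hilbert_cube R).

Lemma column_closed i : closed [set p : Q | co p i = 0].
Proof.
rewrite (_ : [set p | _] = (fun p : Q => co p i) @^-1` [set 0]) //.
apply: (proj1 (continuous_closedP _) (@co_continuous R i)).
exact: accessible_closed_set1 (hausdorff_accessible (@Rhausdorff R)) _.
Qed.

Let columnE n := \bigcup_k \bigcap_m
  [set p : Q | (k <= m)%N -> co p (2 ^ n * (2 * m + 1)) = 0].

Let column_Fsigma n : Fsigma (columnE n).
Proof.
exists (fun k => \bigcap_m [set p : Q | (k <= m)%N -> co p (2 ^ n * (2 * m + 1)) = 0]) => //.
move=> k; apply: closed_bigI => m _; have [km|nkm] := boolP (k <= m)%N.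
  rewrite (_ : [set p | _] = [set p | co p (2 ^ n * (2 * m + 1)) = 0]); first exact: column_closed.
  by apply/seteqP; split=> [p /= /(_ isT)|p /= ?].
rewrite (_ : [set p | _] = setT); first exact: closedT.
by apply/seteqP; split.
Qed.

Lemma Pi3_Fsigmadelta : Fsigmadelta (Pi3 R).
Proof.
exists columnE; first exact: column_Fsigma.
apply/seteqP; split=> [p /Pi3P H n _|p H]; last apply/Pi3P => n.
  by have [k kP] := H n; exists k => // m _; exact: kP.
by have [k _ kP] := H n I; exists k => m; exact: kP.
Qed.

Lemma Sigma4_Fsigmadeltasigma : Fsigmadeltasigma (Sigma4 R).
Proof.
exists (fun n0 => \bigcap_n (if (n0 <= n)%N then columnE n else setT)).
  move=> n0; apply: Fsigmadelta_bigcap => n; apply: Fsigma_Fsigmadelta.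
  by case: ifP => _; [exact: column_Fsigma | apply: closed_Fsigma; exact: closedT].
apply/seteqP; split=> [p /Sigma4P[n0 H]|p [n0 _ H]]; last apply/Sigma4P.
  exists n0 => // n _; case: ifP => // n0n.
  by have [k kP] := H n n0n; exists k => // m _; exact: kP.
exists n0 => n n0n; have := H n I; rewrite n0n => -[k _ kP].
by exists k => m; exact: kP.
Qed.

End Borel_ranks.

(** * Absorbing spaces and pairs *)

Section extensors.
Context {R : realType}.
Notation Q := (hilbert_cube R).

Lemma tail_ideal_ANR (X : set Q) : tail_ideal X -> ANR R (set_type X).
Proof.
move=> Xid; split.
  exact: embedding_separable_metrizable (set_val_embedding X).
move=> Y [[M [h [emb hsurj]]] _] e embe ecl.
have embk : top_embedding (h \o e) by exact: comp_embedding.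
pose k := h \o e; pose A := range k.
have cA : closed A.
  have [_ _ ho] := emb; have [V oV VE] := ho _ (closed_openC ecl).
  rewrite (_ : A = ~` V); first exact: open_closedC.
  apply/seteqP; split=> [_ [x _ <-] Vx|m nV].
    have : (h @^-1` V) (e x) by [].
    by rewrite -VE => H; apply: H; exists x.
  have : [set: M] m by [].
  rewrite -hsurj => -[y _ ym]; have : ~ (h @^-1` V) y by rewrite /= ym.
  by rewrite -VE => /contrapT[x _ xy]; exists x => //; rewrite /k /= xy.
(* The inverse of [k] on [A], extended by an arbitrary value; only its restriction to [A] is
   continuous. *)
have /choice[kinv kinvP] : forall m, exists q : Q, forall x, k x = m -> q = set_val x.
  move=> m; have [[x xm]|nx] := pselect (exists x, k x = m).
    exists (set_val x) => z zm; congr set_val.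
    by case: embk => _ ki _; apply: ki; rewrite -/k zm.
  by exists (mkQ (fun=> 0)) => x xm; case: nx; exists x.
have kinv_within i : {within A, continuous (fun m => co (kinv m) i)}.
  apply/subspace_continuousP => _ [x _ <-] V /= nV.
  have nx : nbhs x [set z : X | V (co (set_val z) i)].
    have sc : continuous (set_val : X -> Q) by case: (set_val_embedding X).
    apply: (cvg_map (sc x) (@co_continuous R i)).
    by rewrite -(kinvP _ x erefl).
  have [kc ki ko] := embk.
  move: nx; rewrite nbhsE => -[W [oW Wx] WV].
  have [W' oW' WE] := ko W oW.
  have nW : nbhs (k x) W'.
    by apply: open_nbhs_nbhs; split=> //; move: Wx; rewrite WE.
  rewrite /within /=; apply: filterS nW => m Wm [z _ zm].
  change (V (co (kinv m) i)); rewrite (kinvP m z zm); apply: (WV z); rewrite WE /=.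
  by move: Wm; rewrite -zm.
have nM : normal_space M by exact: pseudometric_normal.
have /choice[g gP] : forall i, exists g : M -> R,
    (forall m, A m -> g m = co (kinv m) i) /\ continuous g.
  move=> i; have [] := @continuous_bounded_extension M R nM A cA
    (fun m => co (kinv m) i) 1 ltr01 (kinv_within i).
    by move=> m _; rewrite ger0_norm ?co_ge0 ?co_le1.
  move=> g [gA gc _]; exists g; split=> // m Am.
  by rewrite gA //; exact: mem_set.
(* The Tietze extensions are bounded by 1 in absolute value but may be negative; the clamping in
   [mkQ] brings them back to the unit interval. *)
pose F (m : M) : Q := mkQ (fun i => g i m).
have FA m : A m -> F m = kinv m.
  move=> Am; apply: co_inj => i.
  by rewrite co_mkQ_clamp (gP i).1 // clamp_id // co_itv.
have Fc : continuous F.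
  apply/continuousQP => i m.
  rewrite (_ : (fun x => _) = (@clamp R) \o g i); last first.
    by apply/funext => z; rewrite co_mkQ_clamp.
  exact: (cvg_map ((gP i).2 m) (@clamp_continuous R)).
have MP := mdist_pdist M.
pose d := dset (@mdist R M) A.
have dc : continuous d.
  move=> m; apply: (proj2 (@cvgrPdist_lt _ _ _ (nbhs m) (nbhs_filter m) _ _)) => r r0.
  apply/(metric_emb_nbhs _ _ (@id_embedding M)); exists r => // z /= mz.
  apply: le_lt_trans mz; rewrite ler_norml.
  have := dset_lip MP A m z; have := dset_lip MP A z m.
  by rewrite (metric_sym z) -/(d m) -/(d z); lra.
(* On [A] the parameter is 0 and [F] is kept; off [A] the result is finitely supported and therefore
   lies in [X]. *)
pose r' m := splice (d m) (F m) (mkQ (fun=> 0)).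
have r'c : continuous r'.
  by move=> m; apply: splice_cvg; [exact: dc | exact: Fc | exact: cvg_cst].
have r'A x : r' (k x) = set_val x.
  rewrite /r' /d (dset_eq0 MP); last by exists x.
  rewrite splice0 FA; last by exists x.
  exact: kinvP.
have r'X m : range (set_val : X -> Q) (r' m).
  have [[x _ <-]|nA] := pselect (A m); first by rewrite r'A; exists x.
  rewrite set_val_range; apply: tail_ideal_finite Xid _.
  have d0 : 0 < d m.
    rewrite lt_neqAle (dset_ge0 MP) andbT eq_sym; apply/eqP => d0; apply: nA.
    apply: cA => B /(metric_emb_nbhs _ _ (@id_embedding M))[s s0 sB].
    have [||a Aa] := @dset_lt _ _ _ MP A m (Num.min s 1).
    - by rewrite -/(d m) d0 lt_min s0 ltr01.
    - by rewrite ge_min lexx orbT.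
    - by rewrite lt_min => /andP[ma _]; exists a; split=> //; exact: sB.
  have [N HN] := splice_tail d0; exists N => i Ni.
  by rewrite /r' HN // co_mkQ // lexx ler01.
have [s sc sE] := lift_through (set_val_embedding X) r'c r'X.
exists setT; split; [exact: openT | by [] |].
have hc : continuous h by case: emb.
have vc : continuous (set_val : [set: Y] -> Y) by case: (set_val_embedding [set: Y]).
exists (fun u => s (h (set_val u))).
  by move=> u; exact: (cvg_map (cvg_map (vc u) hc) sc).
move=> u x ux; apply: set_val_inj; rewrite sE ux.
exact: r'A.
Qed.

End extensors.

(** * The topological sum of the cubes as an F_sigma subset of the Hilbert cube *)

Section sum_of_cubes.
Context {R : realType}.
Notation Q := (hilbert_cube R).

Let cubes := {n : nat & cube R n.+1}.

(** The even coordinates mark the summand, the odd ones list the point of the cube, padded by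
    zeros. *)
Definition cubes_to_Q (z : cubes) : Q :=
  mkQ (fun i => if odd i then
      (if (i./2 <= tag z)%N then set_val (tagged z (inord i./2)) else 0)
    else (i./2 == tag z)%:R).

Lemma co_cubes_to_Q z i : co (cubes_to_Q z) i =
  if odd i then (if (i./2 <= tag z)%N then set_val (tagged z (inord i./2)) else 0)
  else (i./2 == tag z)%:R.
Proof.
rewrite co_mkQ //; case: ifP => _; last by case: eqP => _; rewrite ?lexx ?ler01.
by case: ifP => _; [exact: (set_valP (tagged z _)) | rewrite lexx ler01].
Qed.

Let piece n (x : cube R n.+1) : Q := cubes_to_Q (existT _ n x).

Let piece_continuous n : continuous (@piece n).
Proof.
apply/continuousQP => i.
rewrite (_ : (fun x => _) = fun x : cube R n.+1 =>
  if odd i then (if (i./2 <= n)%N then set_val (x (inord i./2)) else 0)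
  else (i./2 == n)%:R); last by apply/funext => x; rewrite co_cubes_to_Q.
case: (odd i); last exact: cst_continuous.
case: (i./2 <= n)%N; last exact: cst_continuous.
move=> x; apply: (@cvg_map _ _ _ _ (nbhs_filter x) (fun x : cube R n.+1 => x (inord i./2)) set_val).
  exact: (@proj_continuous 'I_n.+1 (fun=> unit_interval R) (inord i./2) x).
exact: (@initial_continuous (unit_interval R) R set_val).
Qed.

Let piece_inj n : injective (@piece n).
Proof.
move=> x y E; apply/funext => i; apply: set_val_inj.
have := congr1 (fun p => co p i.*2.+1) E.
rewrite !co_cubes_to_Q /= odd_double /= uphalf_double.
by rewrite -ltnS ltn_ord inord_val.
Qed.

Lemma cubes_to_Q_inj : injective cubes_to_Q.
Proof.
move=> [n x] [m y] E; have nm : n = m.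
  have := congr1 (fun p => co p n.*2) E; rewrite !co_cubes_to_Q odd_double /= doubleK eqxx.
  by case: eqP => // _ /eqP; rewrite oner_eq0.
by move: y E; rewrite -nm => y E; congr existT; exact: piece_inj.
Qed.

Let cube_compact n : compact [set: cube R n].
Proof.
have := @tychonoff 'I_n (fun=> unit_interval R) (fun=> setT)
  (fun=> unit_interval_compact).
by congr (compact _); apply/seteqP; split.
Qed.

Let piece_embedding n : top_embedding (@piece n).
Proof.
apply: compact_embedding; [exact: cube_compact | exact: Q_hausdorff |
  exact: piece_continuous | exact: piece_inj].
Qed.

Lemma cubes_to_Q_embedding : top_embedding cubes_to_Q.
Proof.
apply: nbhs_embedding.
- by move=> [n x] V nV; exact: piece_continuous nV.
- exact: cubes_to_Q_inj.
move=> [n x] A nA.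
have nx : nbhs x [set z | A (existT _ n z)] by exact: nA.
have [e e0 eA] := proj1 (emb_nbhs (piece_embedding n) _ _) nx.
exists ([set q | dQ (piece x) q < e] `&` [set q | 2^-1 < co q n.*2]).
  (* The condition on coordinate [n.*2] isolates the [n]-th summand, where the marker is 1. *)
  apply: filterI; first by apply/nbhsQP; exists e.
  have := @co_continuous R n.*2 (piece x) [set r | 2^-1 < r]; apply.
  apply: open_nbhs_nbhs; split; first exact: open_gt.
  rewrite /= /piece co_cubes_to_Q odd_double /= doubleK eqxx.
  by rewrite invf_lt1 ?ltr1n.
move=> [m y] [/= H1 H2]; have mn : m = n.
  move: H2; rewrite co_cubes_to_Q odd_double /= doubleK.
  by case: eqP => // _; rewrite ltNge invr_ge0 ler0n.
by move: y H1 H2; rewrite mn => y H1 _; exact: (eA y).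
Qed.

Lemma cubes_to_Q_range_Fsigma : Fsigma (range cubes_to_Q).
Proof.
exists (fun n => range (@piece n)).
  move=> n; apply: compact_closed; first exact: Q_hausdorff.
  apply: continuous_compact; last exact: cube_compact.
  exact/continuous_subspaceT/piece_continuous.
apply/seteqP; split=> [_ [[n x] _ <-]|_ [n _ [x _ <-]]].
  by exists n => //; exists x.
by exists (existT _ n x).
Qed.

(** Each summand is open, hence its image is relatively open in the range; points off the range are
    separated by its open complement. *)
Lemma closed_embedding_discrete_family (Y : topologicalType) (g : cubes -> Y) :
  top_embedding g -> closed (range g) ->
  discrete_family (fun n => [set g (existT _ n x) | x in [set: cube R n.+1]]).
Proof.
move=> [_ gi go] cg y; have [[[n x] _ <-]|ny] := pselect (range g y); last first.
  exists (~` range g); first by apply: open_nbhs_nbhs; split=> //; exact: closed_openC.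
  by move=> i j [_ [[z _ <-] nz]]; case: nz; exists (existT _ i z).
have oO : open (existT (fun n => cube R n.+1) n @` setT).
  by apply: existT_open_map; exact: openT.
have [V oV VE] := go _ oO.
exists V; first by apply: open_nbhs_nbhs; split=> //;
  rewrite -[V _]/((g @^-1` V) (existT _ n x)) -VE; exists x.
have Vn i z : V (g (existT _ i z)) -> i = n.
  move=> Vz; have : (g @^-1` V) (existT _ i z) by [].
  by rewrite -VE => -[w _ /(congr1 tag)].
by move=> i j [_ [[z _ <-] /Vn ->]] [_ [[w _ <-] /Vn ->]].
Qed.

End sum_of_cubes.

Section absorbing.
Context {R : realType}.
Notation Q := (hilbert_cube R).

(** Allows strong universality to be applied with no prescribed values, as SDAP requires. *)
Lemma Z_embedding_on_set0 (C Y : topologicalType) (f : C -> Y) :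
  continuous f -> Z_embedding_on set0 f.
Proof.
move=> fc; have none (P : Prop) : (set0 : set C) -> P by case=> x /set_mem.
split; last first.
  rewrite (_ : range _ = set0); last by apply/seteqP; split=> // y [x]; exact: none.
  split; first exact: closed0.
  move=> U [Uo Uc]; exists id; split; first by move=> x; exact: cvg_id.
    by rewrite setI0.
  move=> x; have : [set: Y] x by [].
  by rewrite -Uc => -[V UV Vx]; exists V.
split; [by move=> x; exact: none x | by move=> x; exact: none x |].
move=> V _; exists setT; first exact: openT.
by apply/seteqP; split=> x; exact: none x.
Qed.

Context {X : set Q} {bor : forall Y : topologicalType, set Y -> Prop}.
Hypothesis Xideal : tail_ideal X.
Hypothesis Xzero : forall p, X p -> exists i, co p i = 0.
Hypothesis Xspike : X spike.
Hypothesis bor_code : forall S : set Q, bor S ->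
  exists F, forall p, X (code F p) <-> S p.
Hypothesis borX : bor X.
Hypothesis bor_closed : forall S T : set Q, bor S -> closed T -> bor (S `&` T).
Hypothesis bor_Fsigma : forall S : set Q, Fsigma S -> bor S.
Hypothesis bor_absolute : forall (A Y : topologicalType) (io : A -> Q) (e : A -> Y)
  (jY : Y -> Q), top_embedding io -> top_embedding e -> top_embedding jY ->
  bor (range io) -> bor (range e).

Let CC := absolute_class R bor.

Let CC_embedding (A : topologicalType) (io : A -> Q) :
  top_embedding io -> bor (range io) -> CC A.
Proof.
move=> emb bA; split; first exact: embedding_separable_metrizable emb.
by move=> Y /separable_metrizable_embedding[jY embY] e embe; exact: (bor_absolute emb embe embY bA).
Qed.

Let CC_range (A : topologicalType) (io : A -> Q) :
  CC A -> top_embedding io -> bor (range io).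
Proof.
move=> [_ H] emb; apply: H emb.
exact: embedding_separable_metrizable (@id_embedding _).
Qed.

Let emb := set_val_embedding X.

Let Eideal : tail_ideal (range (set_val : X -> Q)).
Proof. by rewrite set_val_range. Qed.

(** Here the ambient space is [X] itself: a code lies in [X] exactly over the range of [j], which
    supplies both [cE] and [c_reduct]. *)
Let universal_map_to_X (D : topologicalType) (j : D -> Q) (B : set D)
    (f : D -> X) (U : set (set X)) :
  top_embedding j -> bor (range j) ->
  closed B -> continuous f -> Z_embedding_on B f -> open_cover U ->
  exists g : D -> X, [/\ continuous g, Z_embedding g,
    forall x, B x -> g x = f x & forall x, exists V, [/\ U V, V (f x) & V (g x)]].
Proof.
move=> embj bj cB fc ZB Uc; have [F FP] := bor_code bj.
have jX x : range (set_val : X -> Q) (code F (j x)).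
  by rewrite set_val_range; apply/FP; exists x.
have reduct p : closure (range j) p -> range (set_val : X -> Q) (code F p) -> range j p.
  by move=> _; rewrite set_val_range => /FP.
have spikeX : range (set_val : X -> Q) spike by rewrite set_val_range.
have [g [gc gZ gB gU _]] := universal_map emb Eideal embj (@code_continuous R F)
  jX reduct (@code_separates R F) spikeX (code_spike F) cB fc ZB Uc.
by exists g.
Qed.

Lemma tail_ideal_absorbing : absorbing R CC (set_type X).
Proof.
split.
- exact: tail_ideal_ANR.
- move=> f fc U Uc.
  have bj : bor (range (@cubes_to_Q R)) by apply: bor_Fsigma; exact: cubes_to_Q_range_Fsigma.
  have [g [gc [gemb [gcl _]] _ gU]] := universal_map_to_X cubes_to_Q_embedding bj
    (@closed0 _) fc (Z_embedding_on_set0 fc) Uc.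
  by exists g; split=> //; exact: closed_embedding_discrete_family.
(* Every point of [X] has a vanishing coordinate, so the coordinate hyperplanes cover [X]. *)
- pose X_ i := [set y : X | co (set_val y) i = 0].
  have cX i : closed (X_ i).
    have sc : continuous (set_val : X -> Q) by case: emb.
    exact: (proj1 (continuous_closedP _) sc _ (@column_closed R i)).
  exists X_.
    move=> i; split; last exact: (coordinate_hyperplane_Z_set emb Eideal (i := i)).
    apply: (CC_embedding (comp_embedding (set_val_embedding (X_ i)) emb)).
    rewrite (_ : range _ = X `&` [set p | co p i = 0]).
      by apply: bor_closed => //; exact: column_closed.
    apply/seteqP; split=> [_ [x _ <-]|p [Xp p0]].
      by split; [exact: (set_valP (set_val x)) | exact: (set_valP x)].
    have Xi : X_ i (SigSub (mem_set Xp)) by [].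
    by exists (SigSub (mem_set Xi)).
  apply/seteqP; split=> // y _; have [i yi] := Xzero (set_valP y).
  by exists i.
- move=> C CCC B cB f fc ZB U Uc.
  have [j embj] := separable_metrizable_embedding CCC.1.
  have [g [gc gZ gB gU]] := universal_map_to_X embj (CC_range CCC embj) cB fc ZB Uc.
  by exists g.
Qed.

Lemma tail_ideal_absorbing_pair : absorbing_pair R CC X.
Proof.
have emid := @id_embedding Q.
have rid : range (@id Q) = setT by apply/seteqP; split=> // p _; exists p.
have idid : tail_ideal (range (@id Q)) by rewrite rid.
split.
- by apply: (CC_embedding emb); rewrite set_val_range.
- move=> K C [sK cK CCC] B cB f fc ZB fB U Uc.
  have [j embj] := separable_metrizable_embedding sK.
  (* The coded set is the image of [C], while [j] embeds all of [K]; the code of [j x] is then in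
     [X] exactly for [x] in [C]. *)
  have bj := CC_range CCC (comp_embedding (set_val_embedding C) embj).
  have [F FP] := bor_code bj.
  have FC x : X (code F (j x)) <-> C x.
    rewrite FP; split=> [[z _ /(emb_inj embj) <-]|Cx]; first exact: set_valP.
    by exists (SigSub (mem_set Cx)).
  have cj : closed (range j).
    apply: compact_closed; first exact: Q_hausdorff.
    apply: continuous_compact cK; apply: continuous_subspaceT.
    exact: (emb_continuous embj).
  have inQ p : range (@id Q) p by rewrite rid.
  (* With [Q] as ambient space every code is admissible, and closedness comes from the compactness
     of [K]. *)
  have reduct p : closure (range j) p -> range (@id Q) (code F p) -> range j p.
    by move=> cp _; exact: cj.
  have [g [gc gZ gB gU gn]] := universal_map emid idid embj (@code_continuous R F)
    (fun x => inQ _) reduct (@code_separates R F) (inQ spike) (code_spike F) cB fc ZB Uc.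
  exists g; split=> //; split=> //.
  (* On [B] membership is prescribed by [fB]; off [B] it is decided by the tail, which is that of
     the code. *)
  apply/seteqP; split=> x.
    move=> Xg; have [Bx|nBx] := pselect (B x).
      have : (B `&` f @^-1` X) x by split=> //=; rewrite -gB.
      by rewrite fB => -[].
    apply/FC; apply: tail_ideal_tail Xideal Xg _.
    by have [N HN] := gn x nBx; exists N => i Ni; rewrite HN.
  move=> Cx; have [Bx|nBx] := pselect (B x).
    have : (B `&` C) x by [].
    by rewrite -fB => -[_] /=; rewrite gB.
  apply: (tail_ideal_tail Xideal (proj2 (FC x) Cx)).
  exact: gn.
- exists (\bigcup_i [set p : Q | co p i = 0]); last first.
    by move=> p /Xzero[i p0]; exists i.
  exists (fun i => [set p : Q | co p i = 0]) => // i.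
  have ci := @column_closed R i.
  split; first by apply: subclosed_compact ci (@Q_compact R) _.
  exact: (coordinate_hyperplane_Z_set emid idid (i := i)).
Qed.

End absorbing.

Theorem corollary6p4 (R : realType) :
  (absorbing_pair R (abs_Pi03 R) (Pi3 R) /\
   absorbing R (abs_Pi03 R) (set_type (Pi3 R))) /\
  (absorbing_pair R (abs_Sigma04 R) (Sigma4 R) /\
   absorbing R (abs_Sigma04 R) (set_type (Sigma4 R))).
Proof.
have closed_Fsd (Y : topologicalType) (T : set Y) : closed T -> Fsigmadelta T.
  by move=> cT; apply: Fsigma_Fsigmadelta; exact: closed_Fsigma.
split; split.
- apply: tail_ideal_absorbing_pair => //.
  + exact: Pi3_tail_ideal.
  + exact: Pi3_zero.
  + exact: Pi3_code.
  + exact: Pi3_Fsigmadelta.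
  + by move=> A Y io e jY; exact: Fsigmadelta_absolute.
- apply: tail_ideal_absorbing.
  + exact: Pi3_tail_ideal.
  + exact: Pi3_zero.
  + exact: spike_Pi3.
  + exact: Pi3_code.
  + exact: Pi3_Fsigmadelta.
  + by move=> S T bS /closed_Fsd; exact: Fsigmadelta_setI.
  + by move=> S; exact: Fsigma_Fsigmadelta.
  + by move=> A Y io e jY; exact: Fsigmadelta_absolute.
- apply: tail_ideal_absorbing_pair.
  + exact: Sigma4_tail_ideal.
  + exact: Sigma4_zero.
  + exact: Sigma4_code.
  + exact: Sigma4_Fsigmadeltasigma.
  + by move=> A Y io e jY; exact: Fsigmadeltasigma_absolute.
- apply: tail_ideal_absorbing.
  + exact: Sigma4_tail_ideal.
  + exact: Sigma4_zero.
  + by apply: Pi3_sub_Sigma4; exact: spike_Pi3.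
  + exact: Sigma4_code.
  + exact: Sigma4_Fsigmadeltasigma.
  + by move=> S T bS /closed_Fsd; exact: Fsigmadeltasigma_setI.
  + by move=> S /Fsigma_Fsigmadelta; exact: Fsigmadelta_Fsigmadeltasigma.
  + by move=> A Y io e jY; exact: Fsigmadeltasigma_absolute.
Qed.
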